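(* The space $(\Sigma,\#,\Delta)$ is a cocommutative Hopf algebra.
   Context: Let $\Bbbk$ be a field of characteristic zero. $\Sigma=\bigoplus_n\Sigma_n$ is the space of non-commutative symmetric functions (descents): $\Sigma_n\subseteq\Bbbk S_n$ has basis $X_\alpha=\sum_{\mathrm{Des}(\sigma)\subseteq\{a_1,a_1+a_2,\dots,a_1+\cdots+a_{r-1}\}}\sigma$, for $\alpha=(a_1,\dots,a_r)$ a composition of $n$, with $\mathrm{Des}(\sigma)=\{i:\sigma(i)>\sigma(i+1)\}$. The Heisenberg product $\#$ on $\Sigma$ is the restriction of the Heisenberg product of permutations; explicitly, for compositions $\alpha=(a_1,\dots,a_r)$ of $p$, $\beta=(b_1,\dots,b_s)$ of $q$, $$X_\alpha\#X_\beta=\sum_{n=\max(p,q)}^{p+q}\sum_{M\in\mathcal M^n_{\alpha,\beta}}X_{c(M)},$$ where $\mathcal M^n_{\alpha,\beta}$ is the set of matrices $M=(m_{ij})_{0\le i\le s,\,0\le j\le r}$ of non-negative integers with $m_{00}=0$, column sums $(n-p,a_1,\dots,a_r)$ and row sums $(n-q,b_1,\dots,b_s)$, and $c(M)$ is the composition of non-zero entries of $M$ read left to right and top to bottom. The unit is $X_{()}$ ($()$ the empty composition). The coproduct is $$\Delta(X_{(a_1,\dots,a_r)})=\sum_{\substack{b_i+c_i=a_i\\0\le b_i,c_i\le a_i}}X_{(b_1,\dots,b_r)^{\wedge}}\otimes X_{(c_1,\dots,c_r)^{\wedge}},$$ where $^\wedge$ indicates that parts equal to zero are omitted; the counit sends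 $X_{()}$ to $1$ and $X_\alpha$ to $0$ for $\alpha\ne()$. *)

(* Defs.v *)
From HB Require Import structures.
From mathcomp Require Import all_boot all_order all_algebra all_fingroup.
From mathcomp Require Import finmap generic_quotient ring_quotient boolp zify.
From mathcomp.multinomials Require Import monalg.

Set Implicit Arguments.
Unset Strict Implicit.
Unset Printing Implicit Defensive.

Import GRing.Theory.
Local Open Scope ring_scope.
Local Open Scope quotient_scope.

Section FreeModule.
Variables (k : fieldType) (B : choiceType) (U : lmodType k).

Definition malg_lift (h : B -> U) (g : {malg k[B]}) : U :=
  \sum_(b <- msupp g) g@_b *: h b.

Lemma malg_liftEw (h : B -> U) (g : {malg k[B]}) (d : {fset B}) :
  (msupp g `<=` d)%fset -> malg_lift h g = \sum_(b <- d) g@_b *: h b.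
Proof.
move=> le; rewrite /malg_lift [RHS](big_fsetID _ (mem (msupp g))) /=.
rewrite [X in _ = _ + X]big1_seq ?addr0; last first.
  by move=> b /andP[_]; rewrite !inE => /andP[_ /mcoeff_outdom->]; rewrite scale0r.
apply: eq_fbigl => b; rewrite !inE /=.
by apply/idP/idP => [bg|/andP[]//]; rewrite bg (fsubsetP le).
Qed.

Lemma malg_lift_linear (h : B -> U) : linear (malg_lift h).
Proof.
move=> a f g; pose d := (msupp (a *: f + g) `|` (msupp f `|` msupp g))%fset.
rewrite !(@malg_liftEw h _ d) /d ?fsubsetUl //; last first.
- by rewrite (fsubset_trans (fsubsetUl _ (msupp g))) // fsubsetUr.
- by rewrite (fsubset_trans (fsubsetUr (msupp f) _)) // fsubsetUr.
rewrite scaler_sumr -big_split; apply: eq_bigr => b _ /=.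
by rewrite mcoeffD mcoeffZ scalerDl scalerA.
Qed.

HB.instance Definition _ h :=
  GRing.isLinear.Build k {malg k[B]} U *:%R (malg_lift h) (malg_lift_linear h).

Lemma malg_liftU (h : B -> U) (b : B) : malg_lift h << b >> = h b.
Proof.
rewrite (@malg_liftEw _ _ [fset b]%fset) ?msuppU_le //.
by rewrite big_seq_fset1 mcoeffUU scale1r.
Qed.

End FreeModule.

Lemma malg_lift_id (k : fieldType) (B : choiceType) (g : {malg k[B]}) :
  malg_lift (fun b => << b >>) g = g.
Proof.
rewrite [RHS]monalgE; apply: eq_bigr => b _.
apply/malgP => c; rewrite mcoeffZ !mcoeffU.
by case: eqP; rewrite ?mulr1n ?mulr0n ?mulr1 ?mulr0.
Qed.

Lemma malg_lift_comp (k : fieldType) (B : choiceType) (U W : lmodType k)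
    (f : {linear U -> W}) (h : B -> U) (g : {malg k[B]}) :
  f (malg_lift h g) = malg_lift (f \o h) g.
Proof. by rewrite linear_sum; apply: eq_bigr => b _; rewrite linearZ. Qed.

Section Tensor.
Variables (k : fieldType) (V W : lmodType k).

Local Notation F := {malg k[(V * W)%type]}.

Inductive tensor_rel : F -> Prop :=
| TensorRel0 : tensor_rel 0
| TensorRelD x y : tensor_rel x -> tensor_rel y -> tensor_rel (x + y)
| TensorRelZ a x : tensor_rel x -> tensor_rel (a *: x)
| TensorRelLin_l a v v' w :
    tensor_rel (<< (a *: v + v', w) >> - (a *: << (v, w) >> + << (v', w) >>))
| TensorRelLin_r a v w w' :
    tensor_rel (<< (v, a *: w + w') >> - (a *: << (v, w) >> + << (v, w') >>)).

Definition tensor_rels : {pred F} := fun x => `[< tensor_rel x >].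

Lemma tensor_rels_zmod_closed : zmod_closed tensor_rels.
Proof.
split=> [|x y /asboolP rx /asboolP ry]; apply/asboolP; first exact: TensorRel0.
by rewrite -scaleN1r; apply: TensorRelD => //; apply: TensorRelZ.
Qed.

HB.instance Definition _ :=
  GRing.isZmodClosed.Build F tensor_rels tensor_rels_zmod_closed.

Definition tensor : Type := Quotient.quot tensor_rels.

HB.instance Definition _ := GRing.Zmodule.on tensor.
HB.instance Definition _ := EqQuotient.on tensor.

Definition tensor_pi (x : F) : tensor := \pi_(Quotient.quot tensor_rels) x.

Lemma tensor_piE x y : (tensor_pi x = tensor_pi y) <-> tensor_rel (x - y).
Proof.
by split=> [/eqP|r]; last apply/eqP;
   rewrite /tensor_pi -Quotient.idealrBE; [move/asboolP|apply/asboolP].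
Qed.

Lemma tensor_piD x y : tensor_pi (x + y) = tensor_pi x + tensor_pi y.
Proof. by rewrite /tensor_pi !piE. Qed.

Lemma tensor_reprK (t : tensor) : tensor_pi (repr t) = t.
Proof. exact: reprK. Qed.

Definition tensor_scale (a : k) (t : tensor) : tensor :=
  tensor_pi (a *: repr t).

Lemma tensor_scale_pi a x : tensor_scale a (tensor_pi x) = tensor_pi (a *: x).
Proof.
apply/tensor_piE; rewrite -scalerBr; apply: TensorRelZ.
by apply/tensor_piE; rewrite tensor_reprK.
Qed.

Lemma tensor_scaleA a b t :
  tensor_scale a (tensor_scale b t) = tensor_scale (a * b) t.
Proof. by rewrite -[t]tensor_reprK !tensor_scale_pi scalerA. Qed.

Lemma tensor_scale1 : left_id 1 tensor_scale.
Proof. by move=> t; rewrite -[t]tensor_reprK tensor_scale_pi scale1r. Qed.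

Lemma tensor_scaleDr : right_distributive tensor_scale +%R.
Proof.
move=> a s t; rewrite -[s]tensor_reprK -[t]tensor_reprK -tensor_piD.
by rewrite !tensor_scale_pi scalerDr tensor_piD.
Qed.

Lemma tensor_scaleDl t : {morph tensor_scale^~ t : a b / a + b}.
Proof.
move=> a b; rewrite -[t]tensor_reprK !tensor_scale_pi scalerDl.
by rewrite tensor_piD.
Qed.

HB.instance Definition _ := GRing.Zmodule_isLmodule.Build k tensor
  tensor_scaleA tensor_scale1 tensor_scaleDr tensor_scaleDl.

Lemma tensor_pi_linear : linear tensor_pi.
Proof. by move=> a x y; rewrite tensor_piD -tensor_scale_pi. Qed.

HB.instance Definition _ :=
  GRing.isLinear.Build k F tensor *:%R tensor_pi tensor_pi_linear.

Definition tens (v : V) (w : W) : tensor := tensor_pi << (v, w) >>.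

Lemma tens_bilinear : bilinear_for *:%R *:%R tens.
Proof.
split=> [w a v v'|v a w w']; rewrite /tens -linearP; apply/tensor_piE.
  exact: TensorRelLin_l.
exact: TensorRelLin_r.
Qed.

HB.instance Definition _ :=
  bilinear_isBilinear.Build k V W tensor *:%R *:%R tens tens_bilinear.

Section Lift.
Variables (U : lmodType k) (b : V -> W -> U).

(* The linear map with v ⊗ w |-> b v w; meaningful only when b is bilinear. *)
Definition tensor_lift (t : tensor) : U :=
  malg_lift (fun p : V * W => b p.1 p.2) (repr t).

Hypothesis b_bilin : bilinear_for *:%R *:%R b.

Lemma tensor_lift_pi x :
  tensor_lift (tensor_pi x) = malg_lift (fun p : V * W => b p.1 p.2) x.
Proof.
suff rel0 y : tensor_rel y -> malg_lift (fun p => b p.1 p.2) y = 0.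
  apply/eqP; rewrite -subr_eq0 -linearB; apply/eqP/rel0/tensor_piE.
  exact: tensor_reprK.
elim=> {y} [|x1 y _ Lx _ Ly|a y _ Ly|a v v' w|a v w w'].
- exact: linear0.
- by rewrite linearD /= Lx Ly addr0.
- by rewrite linearZ /= Ly scaler0.
- by rewrite linearB linearP /= !malg_liftU /= (b_bilin.1 w) subrr.
- by rewrite linearB linearP /= !malg_liftU /= (b_bilin.2 v) subrr.
Qed.

Lemma tensor_lift_linear : linear tensor_lift.
Proof.
move=> a s t; rewrite -[s]tensor_reprK -[t]tensor_reprK -linearP.
by rewrite !tensor_lift_pi linearP.
Qed.

Lemma tensor_liftE v w : tensor_lift (tens v w) = b v w.
Proof. by rewrite tensor_lift_pi malg_liftU. Qed.

Lemma tensor_lift_uniq (f : tensor -> U) :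
  linear f -> (forall v w, f (tens v w) = b v w) -> f =1 tensor_lift.
Proof.
move=> lf fE t; pose lfM := GRing.isLinear.Build k _ _ *:%R f lf.
pose g : {linear tensor -> U} := HB.pack f lfM.
rewrite -[t]tensor_reprK tensor_lift_pi -[f _]/(g _) -{1}[repr t]malg_lift_id.
rewrite malg_lift_comp malg_lift_comp; apply: eq_bigr => -[v w] _.
by congr (_ *: _); apply: fE.
Qed.

End Lift.
End Tensor.

Notation "v ⊗ w" := (tens v w) (at level 40, left associativity) : ring_scope.

Section TensorMaps.
Variable k : fieldType.

Definition tensor_map (V V' W W' : lmodType k) (f : V -> V') (g : W -> W') :
    tensor V W -> tensor V' W' :=
  tensor_lift (fun v w => f v ⊗ g w).

Definition tensor_swap (V W : lmodType k) : tensor V W -> tensor W V :=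
  tensor_lift (fun v w => w ⊗ v).

Definition tensor_assoc (U V W : lmodType k) :
    tensor (tensor U V) W -> tensor U (tensor V W) :=
  tensor_lift (fun uv w => tensor_lift (fun u v => u ⊗ (v ⊗ w)) uv).

Definition tensor_mul (V : lmodType k) (mu : V -> V -> V) :
    tensor V V -> tensor V V -> tensor V V :=
  fun s t =>
    tensor_lift (fun a b => tensor_lift (fun c d => mu a c ⊗ mu b d) t) s.

End TensorMaps.

Section HopfAlgebra.
Variables (k : fieldType) (H : lmodType k).
Variables (mu : H -> H -> H) (e : H) (Delta : H -> tensor H H) (eps : H -> k).

Record is_algebra : Prop := IsAlgebra {
  algebra_bilinear : bilinear_for *:%R *:%R mu;
  algebra_assoc : associative mu;
  algebra_unitl : left_id e mu;
  algebra_unitr : right_id e mu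
}.

Record is_coalgebra : Prop := IsCoalgebra {
  coalgebra_linear : linear Delta;
  coalgebra_counit_linear : scalar eps;
  coalgebra_coassoc : forall x,
    tensor_assoc (tensor_map Delta id (Delta x)) = tensor_map id Delta (Delta x);
  coalgebra_counitl : forall x, tensor_lift (fun a b => eps a *: b) (Delta x) = x;
  coalgebra_counitr : forall x, tensor_lift (fun a b => eps b *: a) (Delta x) = x
}.

Record is_bialgebra : Prop := IsBialgebra {
  bialgebra_algebra : is_algebra;
  bialgebra_coalgebra : is_coalgebra;
  bialgebra_comulM : forall x y,
    Delta (mu x y) = tensor_mul mu (Delta x) (Delta y);
  bialgebra_comul1 : Delta e = e ⊗ e;
  bialgebra_counitM : forall x y, eps (mu x y) = eps x * eps y;
  bialgebra_counit1 : eps e = 1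
}.

Record is_antipode (S : H -> H) : Prop := IsAntipode {
  antipode_linear : linear S;
  antipodel : forall x, tensor_lift (fun a b => mu (S a) b) (Delta x) = eps x *: e;
  antipoder : forall x, tensor_lift (fun a b => mu a (S b)) (Delta x) = eps x *: e
}.

Definition is_hopf_algebra : Prop := is_bialgebra /\ exists S, is_antipode S.

Definition cocommutative : Prop := forall x, tensor_swap (Delta x) = Delta x.

End HopfAlgebra.

Definition composition := {s : seq nat | all (leq 1) s}.

Definition hat (s : seq nat) : composition :=
  exist _ [seq a <- s | 1 <= a]%N (filter_all (leq 1) s).

Definition psums (alpha : seq nat) : seq nat :=
  [seq sumn (take j alpha) | j <- iota 1 (size alpha).-1].

(* Letters of a permutation are indexed from 0 in 'I_n, so the descent between
   the consecutive 0-based positions i and j = i + 1 is recorded as the number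
   j, which is the 1-based position of its left letter. *)
Definition Des (n : nat) (s : 'S_n) : {set 'I_n} :=
  [set j : 'I_n | [exists i : 'I_n, (i.+1 == j :> nat) && (s j < s i)%N]].

Lemma sumn_takeS (s : seq nat) j :
  sumn (take j.+1 s) = (sumn (take j s) + nth 0 s j)%N.
Proof.
have [lt_js|le_sj] := ltnP j (size s).
  by rewrite (take_nth 0%N lt_js) sumn_rcons.
by rewrite !take_oversize ?nth_default ?addn0 // leqW.
Qed.

Lemma composition_gt0 (alpha : composition) j :
  (j < size (val alpha))%N -> (0 < nth 0 (val alpha) j)%N.
Proof. by move=> lt_j; have /all_nthP-> := valP alpha. Qed.

Lemma sumn_take_lt (alpha : composition) i j : (i < j <= size (val alpha))%N ->
  (sumn (take i (val alpha)) < sumn (take j (val alpha)))%N.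
Proof.
case/andP; elim: j => // j IHj; rewrite ltnS leq_eqVlt sumn_takeS => i_j lt_j.
have a_gt0 := composition_gt0 lt_j.
case/predU1P: i_j => [->|/IHj/(_ (ltnW lt_j)) lt_ij].
  by rewrite -[X in (X < _)%N]addn0 ltn_add2l.
exact: leq_trans lt_ij (leq_addr _ _).
Qed.

Lemma psums_sorted (alpha : composition) : sorted ltn (psums (val alpha)).
Proof.
have := iota_ltn_sorted 1 (size (val alpha)).-1.
apply: (homo_sorted_in (P := mem (iota 1 (size (val alpha)).-1))); last first.
  by apply/allP.
move=> i j _; rewrite -[_ \in _]/(j \in iota _ _) mem_iota => /andP[_ lt_j].
by rewrite /= => lt_ij; apply: sumn_take_lt; lia.
Qed.

Lemma psums_bounds (alpha : composition) i :
  i \in psums (val alpha) -> (0 < i < sumn (val alpha))%N.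
Proof.
case/mapP => j; rewrite mem_iota => /andP[j_gt0 lt_j] ->.
have {}lt_j : (j < size (val alpha))%N.
  by lia.
rewrite -{3}[val alpha]take_size sumn_take_lt ?lt_j //= andbT.
by have := @sumn_take_lt alpha 0 j; rewrite take0; apply; rewrite j_gt0 ltnW.
Qed.

Lemma composition_size0 (alpha : composition) :
  (size (val alpha) == 0)%N = (sumn (val alpha) == 0)%N.
Proof. by case: alpha => -[|[|a] s] /=. Qed.

Lemma psums_max (alpha beta : composition) :
    sumn (val alpha) = sumn (val beta) ->
    {subset psums (val alpha) <= psums (val beta)} ->
    (size (val beta) <= size (val alpha))%N ->
  alpha = beta.
Proof.
move=> eq_sum sub le_size.
have szE (gamma : composition) :
  size (psums (val gamma)) = (size (val gamma)).-1.
  by rewrite size_map size_iota.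
have uniqP (gamma : composition) : uniq (psums (val gamma)).
  exact: (sorted_uniq ltn_trans ltnn (psums_sorted gamma)).
have [eq_sz eqm] : (size (psums (val alpha)) = size (psums (val beta)))
    * (psums (val alpha) =i psums (val beta)).
  have le : (size (psums (val beta)) <= size (psums (val alpha)))%N.
    by rewrite !szE -!subn1 leq_sub2r.
  by have [? ?] := uniq_min_size (uniqP alpha) sub le; split.
have eq_ps : psums (val alpha) = psums (val beta).
  exact: (irr_sorted_eq ltn_trans ltnn (psums_sorted _) (psums_sorted _) eqm).
have eq_size : size (val alpha) = size (val beta).
  move: eq_sz (composition_size0 alpha) (composition_size0 beta).
  by rewrite !szE eq_sum; lia.
have take_eq j : (j <= size (val alpha))%N ->
    sumn (take j (val alpha)) = sumn (take j (val beta)).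
  case: j => [|j]; first by rewrite !take0.
  rewrite leq_eqVlt => /predU1P[->|lt_j].
    by rewrite take_size eq_size take_size.
  have sz_iota : (j < (size (val alpha)).-1)%N.
    by lia.
  have := congr1 (nth 0 ^~ j) eq_ps.
  by rewrite !(nth_map 0%N) ?size_iota -?eq_size ?nth_iota.
apply/val_inj/(@eq_from_nth _ 0%N) => // j lt_j.
have := take_eq j.+1 lt_j; rewrite !sumn_takeS (take_eq j (ltnW lt_j)).
exact: addnI.
Qed.

Lemma perm_with_Des (n : nat) (P : pred nat) :
  exists s : 'S_n, forall j, (j \in Des s) = (0 < j)%N && P j.
Proof.
pose D (i : nat) := #|[set j : 'I_n | ((0 < j)%N && P j) && (j <= i)%N]|.
pose key (i : nat) := ((n - D i) * n + i)%N.
have Dn i : (D i <= n)%N by rewrite -[X in (_ <= X)%N]card_ord max_card.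
pose rk (i : 'I_n) := #|[set j : 'I_n | (key j < key i)%N]|.
have rk_lt i : (rk i < n)%N.
  rewrite -[X in (_ < X)%N]card_ord -cardsT; apply: proper_card.
  by rewrite properE subsetT; apply/subsetPn; exists i; rewrite ?inE ?ltnn.
have rk_mono (i j : 'I_n) : (key i < key j)%N -> (rk i < rk j)%N.
  move=> lt_ij; apply: proper_card; rewrite properE; apply/andP; split.
    by apply/subsetP => l; rewrite !inE => /ltn_trans; apply.
  by apply/subsetPn; exists i; rewrite !inE ?ltnn.
have key_inj (i j : 'I_n) : key i = key j -> i = j.
  by move/(congr1 (modn^~ n)); rewrite !modnMDl !modn_small // => /val_inj.
have rk_inj : injective (fun i => Ordinal (rk_lt i)).
  move=> i j [eq_rk]; apply: key_inj.
  by case: (ltngtP (key i) (key j)) => // /rk_mono; rewrite eq_rk ltnn.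
exists (perm rk_inj) => j; rewrite inE; apply/existsP/idP => [[i]|].
  rewrite !permE /= => /andP[/eqP ij]; apply: contraTT => nPj.
  rewrite -leqNgt ltnW //; apply: rk_mono.
  rewrite /key -ij in nPj *; suff -> : D i.+1 = D i by rewrite ltn_add2l.
  apply: eq_card => l; rewrite !inE (leq_eqVlt l i.+1) ltnS.
  by case: eqP => [->|//]; rewrite (negPf nPj).
case/andP => j_gt0 Pj; have lt_i : (j.-1 < n)%N.
  by apply: leq_ltn_trans (leq_pred _) (ltn_ord j).
exists (Ordinal lt_i); rewrite /= prednK // eqxx !permE /=; apply: rk_mono.
rewrite /key /= -{1}(prednK j_gt0).
have lt_D : (D j.-1 < D j)%N.
  apply: proper_card; rewrite properE; apply/andP; split.
    apply/subsetP => l; rewrite !inE => /andP[-> /leq_trans->] //.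
    exact: leq_pred.
  apply/subsetPn; exists j; rewrite !inE ?j_gt0 ?Pj ?leqnn //=.
  by rewrite -ltnNge prednK.
rewrite prednK //.
have : ((n - D j).+1 * n <= (n - D j.-1) * n)%N.
  rewrite leq_mul2r; apply/orP; right.
  by apply: ltn_sub2l => //; apply: leq_trans lt_D (Dn _).
rewrite mulSn; have := ltn_ord j; lia.
Qed.

Section Sigma.
Variable k : fieldType.

(* The direct sum of the k S_n over all n: the free module on all permutations. *)
Definition kS := {malg k[{n : nat & 'S_n}]}.

HB.instance Definition _ := GRing.Lmodule.on kS.

Definition kS_basis (n : nat) (s : 'S_n) : kS :=
  << existT (fun n => 'S_n) n s >>.

Definition descX (alpha : composition) : kS :=
  \sum_(s : 'S_(sumn (val alpha))
       | [forall j in Des s, (j : nat) \in psums (val alpha)])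
    kS_basis s.

Lemma mcoeff_descX alpha n (s : 'S_n) :
  (descX alpha : {malg k[{n : nat & 'S_n}]})@_(existT (fun n => 'S_n) n s) =
    ((sumn (val alpha) == n)
     && [forall j in Des s, (j : nat) \in psums (val alpha)])%:R.
Proof.
rewrite raddf_sum /=; have [eq_n|neq_n] := eqVneq; last first.
  rewrite big1 // => t _; rewrite mcoeffU; case: eqP => // eq_ts.
  by case/eqP: neq_n; case: eq_ts.
move: s; case: n / eq_n => s /=; 
have [Ds|nDs] :=
  boolP [forall j in Des s, (j : nat) \in psums (val alpha)].
  rewrite (bigD1 s) //= mcoeffUU big1 ?addr0 // => t /andP[_ neq_ts].
  rewrite mcoeffU; case: eqP => // /eqP; rewrite eq_Tagged /= => eq_ts.
  by rewrite eq_ts in neq_ts.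
rewrite big1 // => t Dt; rewrite mcoeffU; case: eqP => // /eqP.
by rewrite eq_Tagged /= => /eqP eq_ts; rewrite -eq_ts Dt in nDs.
Qed.

Lemma descX_free (f : {malg k[composition]}) : malg_lift descX f = 0 -> f = 0.
Proof.
move=> f0; apply/malgP => a0; rewrite mcoeff0; apply/eqP.
rewrite mcoeff_eq0; apply: contraT; rewrite negbK => a0f.
pose P m := has (fun a : composition => size (val a) == m) (msupp f).
have exP : exists m, P m by exists (size (val a0)); apply/hasP; exists a0.
have ubP m : P m -> (m <= \max_(a <- msupp f) size (val a))%N.
  by case/hasP => a af /eqP<-; apply: leq_bigmax_seq.
have [m /hasP[a af /eqP sz_a] max_m] := ex_maxnP exP ubP.
have [s Ds] := perm_with_Des (sumn (val a)) (mem (psums (val a))).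
have := congr1 (mcoeff (existT (fun n => 'S_n) _ s)) f0.
rewrite mcoeff0 raddf_sum /= (big_fsetD1 a) //= mcoeffZ mcoeff_descX eqxx /=.
rewrite big1_fset ?addr0 => [|b].
  case: forall_inP => [_|[]]; first by rewrite mulr1 => /eqP; rewrite mcoeff_eq0 af.
  by move=> j; rewrite Ds => /andP[].
rewrite !inE => /andP[neq_ba bf] _; rewrite mcoeffZ mcoeff_descX.
case: eqP => [eq_sum|]; last by rewrite mulr0.
case: forall_inP => [Dsb|]; last by rewrite mulr0.
case/eqP: neq_ba; apply/esym/psums_max => // [i ia|]; last first.
  by rewrite sz_a; apply: max_m; apply/hasP; exists b.
have /andP[i_gt0 lt_i] := psums_bounds ia.
by apply: (Dsb (Ordinal lt_i)); rewrite Ds i_gt0.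
Qed.

(* The span of all X_alpha; since X_alpha lies in k S_n for alpha a composition
   of n, this is the direct sum over n of the spans Sigma_n. *)
Definition Sigma_pred : {pred kS} :=
  fun x => `[< exists f : {malg k[composition]}, x = malg_lift descX f >].

Lemma Sigma_submod_closed : submod_closed Sigma_pred.
Proof.
split=> [|a x y /asboolP[f ->] /asboolP[g ->]]; apply/asboolP.
  by exists 0; rewrite linear0.
by exists (a *: f + g); rewrite linearP.
Qed.

HB.instance Definition _ :=
  GRing.isSubmodClosed.Build k kS Sigma_pred Sigma_submod_closed.

Record Sigma := MkSigma { Sigma_val : kS; Sigma_valP : Sigma_val \in Sigma_pred }.

HB.instance Definition _ := [isSub for Sigma_val].
HB.instance Definition _ := [Choice of Sigma by <:].
HB.instance Definition _ := [SubChoice_isSubLmodule of Sigma by <:].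

Lemma descX_Sigma alpha : descX alpha \in Sigma_pred.
Proof. by apply/asboolP; exists << alpha >>; rewrite malg_liftU. Qed.

Definition X (alpha : composition) : Sigma := MkSigma (descX_Sigma alpha).

(* The coordinates of x in the basis X; the choice is unique by X_free below. *)
Definition coord (x : Sigma) : {malg k[composition]} :=
  sval (cid (asboolP _ (Sigma_valP x))).

Lemma coordK x : malg_lift X (coord x) = x.
Proof.
apply: val_inj; rewrite [RHS](svalP (cid (asboolP _ (Sigma_valP x)))) /coord.
by rewrite raddf_sum; apply: eq_bigr => a _; exact: linearZ.
Qed.

Lemma X_free f : malg_lift X f = 0 -> f = 0.
Proof.
move/(congr1 (@Sigma_val)) => f0; apply: descX_free; rewrite -[RHS]f0.
rewrite -[Sigma_val]/(val : Sigma -> kS) raddf_sum.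
by apply: eq_bigr => a _; apply/esym; exact: linearZ.
Qed.

Lemma X_liftK : cancel (malg_lift X) coord.
Proof.
move=> f; apply/eqP; rewrite -subr_eq0; apply/eqP/X_free.
by rewrite linearB /= coordK subrr.
Qed.

Lemma coord_linear : linear coord.
Proof.
by move=> a x y; rewrite -{1}[x]coordK -{1}[y]coordK -linearP X_liftK.
Qed.

Section Lift.
Variables (U : lmodType k) (h : composition -> U).

(* The linear map with X alpha |-> h alpha *)
Definition Sigma_lift (x : Sigma) : U := malg_lift h (coord x).

Lemma Sigma_lift_linear : linear Sigma_lift.
Proof. by move=> a x y; rewrite /Sigma_lift coord_linear linearP. Qed.

HB.instance Definition _ :=
  GRing.isLinear.Build k Sigma U *:%R Sigma_lift Sigma_lift_linear.

Lemma Sigma_liftX alpha : Sigma_lift (X alpha) = h alpha.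
Proof. by rewrite /Sigma_lift -(malg_liftU X) X_liftK malg_liftU. Qed.

End Lift.

(* Since M has total sum n, bounding its entries by n loses no matrix; the bound
   makes the set finite. Row and column 0 have index ord0. *)
Definition heis_matrices (alpha beta : seq nat) (n : nat) :
    {set 'M['I_n.+1]_((size beta).+1, (size alpha).+1)} :=
  [set M : 'M['I_n.+1]_((size beta).+1, (size alpha).+1) |
    [&& M ord0 ord0 == 0 :> nat,
        [forall j, (\sum_i (M i j : nat))%N
                   == nth 0 ((n - sumn alpha)%N :: alpha) j] &
        [forall i, (\sum_j (M i j : nat))%N
                   == nth 0 ((n - sumn beta)%N :: beta) i]]].

Definition mx_reading (n r s : nat) (M : 'M['I_n]_(r, s)) : composition :=
  hat [seq (M i j : nat) | i <- enum 'I_r, j <- enum 'I_s].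

Definition heisX (alpha beta : composition) : Sigma :=
  \sum_(maxn (sumn (val alpha)) (sumn (val beta)) <= n
          < (sumn (val alpha) + sumn (val beta)).+1)
    \sum_(M in heis_matrices (val alpha) (val beta) n) X (mx_reading M).

Definition heis (x y : Sigma) : Sigma :=
  Sigma_lift (fun alpha => Sigma_lift (heisX alpha) y) x.

Definition Sigma_one : Sigma := X (hat [::]).

Definition SigmaDeltaX (alpha : composition) : tensor Sigma Sigma :=
  let r := size (val alpha) in let n := sumn (val alpha) in
  \sum_(b : {ffun 'I_r -> 'I_n.+1})
    \sum_(c : {ffun 'I_r -> 'I_n.+1}
          | [forall i, (b i + c i)%N == nth 0 (val alpha) i])
      X (hat [seq (b i : nat) | i <- enum 'I_r])
      ⊗ X (hat [seq (c i : nat) | i <- enum 'I_r]).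

Definition SigmaDelta (x : Sigma) : tensor Sigma Sigma :=
  Sigma_lift SigmaDeltaX x.

Definition Sigma_eps (x : Sigma) : k :=
  @Sigma_lift k^o (fun alpha => (val alpha == [::])%:R) x.

Lemma heisXX alpha beta : heis (X alpha) (X beta) = heisX alpha beta.
Proof. by rewrite /heis !Sigma_liftX. Qed.

Lemma SigmaDelta_X alpha : SigmaDelta (X alpha) = SigmaDeltaX alpha.
Proof. exact: Sigma_liftX. Qed.

Lemma Sigma_eps_X alpha : Sigma_eps (X alpha) = (val alpha == [::])%:R.
Proof. exact: (@Sigma_liftX k^o). Qed.

End Sigma.

Arguments Sigma_one {k}.

(* Main.v *)
(* Index the parts of a weak composition by a finite type, writing X_a for X of
   the composition of nonzero parts of a.  Then
     Delta X_a = sum over b + c = a of X_b ⊗ X_c,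
     X_a # X_b = sum of X_M over all matrices M with M_00 = 0 whose column sums
                 off column 0 are a and row sums off row 0 are b,
   i.e. the series H(t) = sum_a t^a X_a are group-like and H(t) # H(u) is H at
   the ordered family of products t_j u_i, (i,j) <> (0,0), with t_0 = u_0 = 1.
   All bialgebra axioms are then bijections between sets of arrays.  The product
   is not graded, but the coproduct is, so id - u.eps is locally nilpotent for
   convolution and the antipode is the alternating sum of its powers. *)
From HB Require Import structures.
Require Import Defs.
From mathcomp Require Import all_boot all_order all_algebra.
From mathcomp Require Import finmap boolp classical_sets functions cardinality.
From mathcomp Require Import fsbigop zify.

Set Implicit Arguments.
Unset Strict Implicit.
Unset Printing Implicit Defensive.

Import GRing.Theory.
Local Open Scope ring_scope.
Local Open Scope classical_set_scope.

(** * Finite sums over sets *)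

Section FiniteSums.

(** Listing the pairs fibre by fibre gives a duplicate-free enumeration of the dependent product. *)
Lemma pair_fsbig_dep (V : nmodType) (I J : choiceType) (A : set I)
    (B : I -> set J) (F : I -> J -> V) :
  finite_set A -> (forall i, A i -> finite_set (B i)) ->
  \sum_(i \in A) \sum_(j \in B i) F i j = \sum_(p \in A `*`` B) F p.1 p.2.
Proof.
move=> finA finB; have finAB := finite_setXR finA finB.
rewrite fsbig_finite // [RHS]fsbig_finite //.
transitivity (\sum_(i <- fset_set A) \sum_(j <- fset_set (B i)) F i j).
  apply: eq_big_seq => i; rewrite in_fset_set // inE => Ai.
  by rewrite fsbig_finite //; apply: finB.
pose s := [seq (i, j) | i <- fset_set A, j <- fset_set (B i)].
transitivity (\sum_(p <- s) F p.1 p.2); first by rewrite big_allpairs_dep.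
apply: perm_big; apply: uniq_perm => [||p]; rewrite ?fset_uniq //.
  apply: allpairs_uniq_dep => [|i _|[i j] [i' j'] _ _ /= [-> ->]] //;
    exact: fset_uniq.
rewrite in_fset_set //; apply/allpairsPdep/idP => [[i [j [iA jB ->]]]|].
  move: iA; rewrite in_fset_set // !inE => Ai; split=> //=.
  by move: jB; rewrite in_fset_set ?inE //; apply: finB.
rewrite inE => -[Ap Bp]; exists p.1, p.2; rewrite !in_fset_set ?inE //.
  by split=> //; case: p {Ap Bp}.
exact: finB.
Qed.

(** Linearity is a hypothesis instead of a bundled structure because the maps met below, such as
    [tensor_lift b] or a product with one factor fixed, come mostly with a mere proof of
    linearity. *)
Lemma fsbig_linear (k : pzRingType) (U V : lmodType k) (f : U -> V)
    (T : choiceType) (A : set T) (F : T -> U) : linear f -> finite_set A ->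
  f (\sum_(t \in A) F t) = \sum_(t \in A) f (F t).
Proof.
move=> lf finA; pose lfM := GRing.isLinear.Build k _ _ *:%R f lf.
pose g : {linear U -> V} := HB.pack f lfM.
by rewrite !fsbig_finite // -[f]/(g : U -> V) linear_sum.
Qed.

Lemma eq_fsbig_set (V : nmodType) (T : choiceType) (A : set T) (F G : T -> V) :
  (forall t, A t -> F t = G t) -> \sum_(t \in A) F t = \sum_(t \in A) G t.
Proof. by move=> FG; apply: eq_fsbigr => t; rewrite inE => /FG. Qed.

(** The array identities below are all proved through this change of variables: with an explicit
    inverse, each one becomes a pointwise verification. *)
Lemma fsbig_bij (V : nmodType) (I J : choiceType) (A : set I) (B : set J)
    (h : I -> J) (g : J -> I) (F : I -> V) (G : J -> V) :
  (forall i, A i -> [/\ B (h i), g (h i) = i & F i = G (h i)]) ->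
  (forall j, B j -> A (g j) /\ h (g j) = j) ->
  \sum_(i \in A) F i = \sum_(j \in B) G j.
Proof.
move=> hA gB; rewrite (reindex_fsbig h A B).
  by apply: eq_fsbig_set => i /hA[].
split=> [i /hA[]//|i i' /set_mem/hA[_ gi _] /set_mem/hA[_ gi' _] eq_h|j /gB[]].
  by rewrite -gi -gi' eq_h.
by move=> Ag hg; exists (g j).
Qed.

(** Such functions all come from the finite type [{ffun I -> 'I_n.+1}]. *)
Lemma finite_bounded_fun (I : finType) (A : set (I -> nat)) n :
  (forall f i, A f -> (f i <= n)%N) -> finite_set A.
Proof.
move=> leAn.
pose h (f : {ffun I -> 'I_n.+1}) i : nat := f i.
apply: sub_finite_set (finite_image h (@finite_finset _ setT)) => f Af.
exists [ffun i => inord (f i)] => //.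
by apply: funext => i; rewrite /h ffunE inordK // ltnS leAn.
Qed.

End FiniteSums.

(** * Weak compositions *)

Section WeakCompositions.

Lemma hat_map_filter (T : eqType) (P : pred T) (f : T -> nat) (s : seq T) :
  (forall x, ~~ P x -> f x = 0%N) ->
  hat [seq f x | x <- s] = hat [seq f x | x <- s & P x].
Proof.
move=> f0; apply: val_inj; rewrite /= !filter_map -filter_predI /=.
congr map; apply: eq_filter => x /=.
by case: (boolP (P x)) => [_|/f0->]; rewrite ?andbT ?andbF.
Qed.

Lemma filter_allpairs (S T : Type) (P : pred S) (Q : pred T) s t :
  [seq p <- [seq (x, y) | x <- s, y <- t] | P p.1 && Q p.2] =
  [seq (x, y) | x <- [seq x <- s | P x], y <- [seq y <- t | Q y]].
Proof.
elim: s => //= x s IHs; rewrite filter_cat IHs filter_map.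
case: ifP => Px.
  by congr (map _ _ ++ _); apply: eq_filter => y /=; rewrite Px.
by rewrite (eq_filter (a2 := pred0)) ?filter_pred0 //= => y /=; rewrite Px.
Qed.

(** This lexicographic order is the reading order of a matrix with rows indexed by [S]; a matrix is
    thus itself a weak composition indexed by a product, and [Xw] applies to it. *)
Lemma enum_prod (S T : finType) :
  enum {: S * T} = [seq (x, y) | x <- enum S, y <- enum T].
Proof. by rewrite [LHS]enumT [in LHS]unlock. Qed.

(** * Extension by zero from a list of indices *)

Section ZeroExtension.
Variables (I : finType) (r : nat) (u : r.-tuple I).
Hypothesis u_uniq : uniq u.

(** Extension by 0 outside [u]: for [i] not in [u] the index is [r], so that [insub] fails and the
    default 0 is taken. *)
Definition zext (x : 'I_r -> nat) (i : I) : nat :=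
  oapp x 0%N (insub (index i u)).

Lemma zext_tnth x j : zext x (tnth u j) = x j.
Proof.
rewrite /zext (tnth_nth (tnth u j)) index_uniq ?size_tuple //.
by rewrite insubT //= => lt_jr; congr x; apply: val_inj.
Qed.

Lemma zext_out x i : i \notin u -> zext x i = 0%N.
Proof.
move=> /negPf iu; rewrite /zext insubF // -{2}(size_tuple u) index_mem.
exact: iu.
Qed.

Lemma zextP i : (exists j, i = tnth u j) \/ i \notin u.
Proof.
have [/tnthP[j ->]|] := boolP (i \in u); last by right.
by left; exists j.
Qed.

Lemma zextK (f : I -> nat) : (forall i, i \notin u -> f i = 0%N) ->
  zext (f \o tnth u) = f.
Proof.
move=> f0; apply: funext => i; have [[j ->]|iu] := zextP i.
  by rewrite zext_tnth.
by rewrite zext_out // f0.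
Qed.

Lemma sum_tnth (f : I -> nat) : (forall i, i \notin u -> f i = 0%N) ->
  (\sum_i f i = \sum_j f (tnth u j))%N.
Proof.
move=> f0; rewrite -(big_tuple _ _ u xpredT f) [RHS]big_uniq //=.
by rewrite [RHS]big_mkcond; apply: eq_bigr => i _; case: ifPn => // /f0.
Qed.

Lemma map_zext x : [seq zext x i | i <- u] = [seq x j | j <- enum 'I_r].
Proof.
rewrite -(map_tnth_enum u) -map_comp.
by apply: eq_map => j /=; rewrite zext_tnth.
Qed.

End ZeroExtension.

End WeakCompositions.

(** * Basis elements of weak compositions and their coproduct *)

Section BasisFormulas.
Variable k : fieldType.

(* [X_a] for a weak composition [a], whose parts are indexed by [I] in
   enumeration order. *)
Definition Xw (I : finType) (a : I -> nat) : Sigma k :=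
  X k (hat [seq a i | i <- enum I]).

Definition splits (I : finType) (a : I -> nat) : set ((I -> nat) * (I -> nat)) :=
  [set p | forall i, (p.1 i + p.2 i)%N = a i].

Lemma finite_splits (I : finType) (a : I -> nat) : finite_set (splits a).
Proof.
pose n := (\max_i a i)%N.
have fin : finite_set [set f : I -> nat | forall i, (f i <= n)%N].
  by apply: (@finite_bounded_fun _ _ n) => f i; apply.
apply: sub_finite_set (finite_setX fin fin) => -[b c] /= bc.
by split=> i /=; apply: leq_trans (leq_bigmax i); rewrite -bc /= ?leq_addr ?leq_addl.
Qed.

Lemma val_hat (s : seq nat) : val (hat s) = [seq a <- s | (0 < a)%N].
Proof. by []. Qed.

Lemma X_Xw (alpha : composition) :
  X k alpha = Xw (fun i : 'I_(size (val alpha)) => nth 0%N (val alpha) i).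
Proof.
congr X; apply: val_inj; rewrite val_hat.
rewrite (map_comp (nth 0%N (val alpha)) val) val_enum_ord -/(mkseq _ _) mkseq_nth.
by apply/esym/all_filterP; exact: valP alpha.
Qed.

(** The zeros added outside [u] are erased by [hat]. That [u] is a filter of [enum I] ensures that
    the remaining parts keep their order. *)
Lemma Xw_zext (I : finType) r (u : r.-tuple I) (P : pred I) (x : 'I_r -> nat) :
  u = [seq i <- enum I | P i] :> seq I ->
  Xw (zext u x) = X k (hat [seq x i | i <- enum 'I_r]).
Proof.
move=> uE; have u_uniq : uniq u by rewrite uE filter_uniq // enum_uniq.
congr X; rewrite (@hat_map_filter _ P) -?uE ?map_zext // => i nPi.
by rewrite zext_out // memtE uE mem_filter (negPf nPi).
Qed.

(** A zero part splits only as 0 + 0, so extension by zero from the support of [a] matches the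
    splits of the composition of nonzero parts with those of [a]. *)
Lemma SigmaDelta_Xw (I : finType) (a : I -> nat) :
  SigmaDelta (Xw a) = \sum_(p \in splits a) Xw p.1 ⊗ Xw p.2.
Proof.
rewrite [in LHS]/Xw SigmaDelta_X /SigmaDeltaX /=.
set s := [seq _ <- _ | _]; set r := size s.
have sE : s = [seq a i | i <- enum I & (0 < a i)%N] by rewrite /s filter_map.
have sz_u : size [seq i <- enum I | (0 < a i)%N] == r by rewrite /r sE size_map.
pose u := Tuple sz_u.
have uE : u = [seq i <- enum I | (0 < a i)%N] :> seq I by [].
have u_uniq : uniq u by rewrite uE filter_uniq // enum_uniq.
have nth_s (j : 'I_r) : nth 0%N s j = a (tnth u j).
  have lt_j : (j < size u)%N by rewrite size_tuple.
  by rewrite (tnth_nth (tnth u j)) sE -(nth_map _ 0%N).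
have a0 i : i \notin u -> a i = 0%N.
  by rewrite memtE uE mem_filter mem_enum andbT -eqn0Ngt => /eqP.
rewrite pair_big_dep /= bigfs ?index_enum_uniq //; last first.
  by move=> i _; rewrite mem_index_enum.
pose h (p : {ffun 'I_r -> 'I_(sumn s).+1} * {ffun 'I_r -> 'I_(sumn s).+1}) :
    (I -> nat) * (I -> nat) :=
  (zext u (fun i => p.1 i), zext u (fun i => p.2 i)).
(* Each part is at most the total, so [inord] in [g] loses nothing. *)
have le_s (j : 'I_r) : (a (tnth u j) <= sumn s)%N.
  by rewrite -nth_s sumnE (big_nth 0%N) big_mkord (bigD1 j) //= leq_addr.
pose g (p : (I -> nat) * (I -> nat)) :
    {ffun 'I_r -> 'I_(sumn s).+1} * {ffun 'I_r -> 'I_(sumn s).+1} :=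
  ([ffun j => inord (p.1 (tnth u j))], [ffun j => inord (p.2 (tnth u j))]).
apply: (fsbig_bij (h := h) (g := g)) => [[b c] /forallP /= bc|[b c] /= bc].
  split; last by rewrite /h /= !(Xw_zext _ uE).
    move=> i /=; have [[j ->]|iu] := zextP u i.
      by rewrite !zext_tnth // -nth_s; apply/eqP/bc.
    by rewrite !zext_out // a0.
  by congr (_, _); apply/ffunP => j; rewrite ffunE /= zext_tnth // inord_val.
have bc_le j : (b (tnth u j) <= sumn s)%N /\ (c (tnth u j) <= sumn s)%N.
  by have := le_s j; have /= := bc (tnth u j); lia.
split.
  apply/forallP => j /=; rewrite !ffunE nth_s; have /= <- := bc (tnth u j).
  by have [? ?] := bc_le j; rewrite !inordK.
rewrite /h /=; congr (_, _); rewrite -[RHS](zextK u_uniq).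
- by congr zext; apply: funext => j /=; rewrite ffunE inordK //; case: (bc_le j).
- by move=> i /a0; have /= := bc i; lia.
- by congr zext; apply: funext => j /=; rewrite ffunE inordK //; case: (bc_le j).
- by move=> i /a0; have /= := bc i; lia.
Qed.

End BasisFormulas.

(** * The Heisenberg product of weak compositions *)

Section HeisenbergFormula.
Variable k : fieldType.

Lemma sum_pair (I J : finType) (f : J * I -> nat) :
  (\sum_p f p = \sum_j \sum_i f (j, i))%N.
Proof. by rewrite pair_big; apply: eq_bigr => -[j i]. Qed.

Section Pointed.
Variables (I J : finType) (i0 : I) (j0 : J).

(* Only the marginals off the base points are prescribed: [M] ranges over the
   matrices of all sizes [n] at once, and associativity becomes the symmetry of
   the three marginals of a three-dimensional array vanishing at its base
   point. *)
Definition marginals (a : I -> nat) (b : J -> nat) : set (J * I -> nat) :=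
  [set M | [/\ M (j0, i0) = 0%N,
    forall i, i != i0 -> (\sum_j M (j, i))%N = a i &
    forall j, j != j0 -> (\sum_i M (j, i))%N = b j]].

(** An entry off column [i0] is at most a part of [a], an entry off row [j0] at most a part of [b],
    and the one remaining entry is 0. *)
Lemma marginals_le a b M j i : marginals a b M ->
  (M (j, i) <= (\sum_i a i + \sum_j b j))%N.
Proof.
case=> M0 Ma Mb.
have [-> | ne_i] := eqVneq i i0; last first.
  rewrite (leq_trans _ (leq_addr _ _)) // (bigD1 i) //= -Ma //.
  by rewrite (bigD1 j) //= -addnA leq_addr.
have [-> | ne_j] := eqVneq j j0; first by rewrite M0.
rewrite (leq_trans _ (leq_addl _ _)) // [leqRHS](bigD1 j) //= -Mb //.
by rewrite (bigD1 i0) //= -addnA leq_addr.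
Qed.

Lemma finite_marginals a b : finite_set (marginals a b).
Proof.
by apply: (@finite_bounded_fun _ _ (\sum_i a i + \sum_j b j)%N) => M [j i];
  apply: marginals_le.
Qed.

(** If [M] has total [n], this says that column [i0] sums to [n] minus the sum of [a], the value
    that [heis_matrices] prescribes for column 0. *)
Lemma marginals_col a b M : a i0 = 0%N -> marginals a b M ->
  (\sum_j M (j, i0) + \sum_i a i = \sum_p M p)%N.
Proof.
move=> a0 [_ Ma _]; rewrite sum_pair exchange_big [RHS](bigD1 i0) //=.
by congr addn; rewrite (bigD1 i0) //= a0; apply: eq_bigr => i /Ma.
Qed.

Lemma marginals_row a b M : b j0 = 0%N -> marginals a b M ->
  (\sum_i M (j0, i) + \sum_j b j = \sum_p M p)%N.
Proof.
move=> b0 [_ _ Mb]; rewrite sum_pair [RHS](bigD1 j0) //=.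
by congr addn; rewrite (bigD1 j0) //= b0; apply: eq_bigr => j /Mb.
Qed.

(** The total is the sum of [b] plus row [j0]; since the corner vanishes, each entry of that row is
    bounded by a part of [a]. The bounds are those of [n] in the Heisenberg product. *)
Lemma marginals_total a b M : a i0 = 0%N -> b j0 = 0%N -> marginals a b M ->
  (maxn (\sum_i a i) (\sum_j b j) <= \sum_p M p <= \sum_i a i + \sum_j b j)%N.
Proof.
move=> a0 b0 mM; have tot_a := marginals_col a0 mM.
have tot_b := marginals_row b0 mM.
rewrite geq_max -{1}tot_a -tot_b !leq_addl leq_add2r /=.
case: mM => M0 Ma _; rewrite (bigD1 i0) //= M0 [leqRHS](bigD1 i0) //= a0.
by apply: leq_sum => i /Ma <-; rewrite (bigD1 j0) //= leq_addr.
Qed.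

End Pointed.

Section ZeroExtension2.
Variables (I J : finType) (r s : nat) (u : r.-tuple I) (v : s.-tuple J).
Hypotheses (u_uniq : uniq u) (v_uniq : uniq v).

Definition zext2 (M : 'I_s -> 'I_r -> nat) (p : J * I) : nat :=
  zext v (fun j => zext u (M j) p.2) p.1.

Lemma zext2_tnth M j i : zext2 M (tnth v j, tnth u i) = M j i.
Proof. by rewrite /zext2 /= !zext_tnth. Qed.

Lemma zext2_outl M j i : j \notin v -> zext2 M (j, i) = 0%N.
Proof. by move=> jv; rewrite /zext2 zext_out. Qed.

Lemma zext2_outr M j i : i \notin u -> zext2 M (j, i) = 0%N.
Proof.
move=> iu; have [[j' ->]|/zext2_outl-> //] := zextP v j.
by rewrite /zext2 /= zext_tnth // zext_out.
Qed.

Lemma zext2K (f : J * I -> nat) :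
  (forall j i, j \notin v -> f (j, i) = 0%N) ->
  (forall j i, i \notin u -> f (j, i) = 0%N) ->
  zext2 (fun j i => f (tnth v j, tnth u i)) = f.
Proof.
move=> fv fu; apply: funext => -[j i].
have [[j' ->]|jv] := zextP v j; last by rewrite zext2_outl // fv.
have [[i' ->]|iu] := zextP u i; last by rewrite zext2_outr // fu.
by rewrite zext2_tnth.
Qed.

Lemma sum_zext2_col M i : (\sum_j zext2 M (j, tnth u i) = \sum_j M j i)%N.
Proof.
rewrite (sum_tnth v_uniq) => [|j jv]; last by rewrite zext2_outl.
by apply: eq_bigr => j _; rewrite zext2_tnth.
Qed.

Lemma sum_zext2_row M j : (\sum_i zext2 M (tnth v j, i) = \sum_i M j i)%N.
Proof.
rewrite (sum_tnth u_uniq) => [|i iu]; last by rewrite zext2_outr.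
by apply: eq_bigr => i _; rewrite zext2_tnth.
Qed.

(** The lexicographic enumeration of [J * I], restricted to rows in [v] and columns in [u], reads
    the small matrix row by row; the other entries are zeros erased by [hat]. *)
Lemma Xw_zext2 (P : pred I) (Q : pred J) M :
  u = [seq i <- enum I | P i] :> seq I -> v = [seq j <- enum J | Q j] :> seq J ->
  Xw k (zext2 M) = X k (hat [seq M j i | j <- enum 'I_s, i <- enum 'I_r]).
Proof.
move=> uE vE; congr X.
rewrite (@hat_map_filter _ (fun p => Q p.1 && P p.2)) => [|[j i] /=].
  rewrite enum_prod filter_allpairs -uE -vE map_allpairs /=; congr hat.
  rewrite -[in LHS](map_tnth_enum u) -[in LHS](map_tnth_enum v).
  rewrite allpairs_mapl allpairs_mapr.
  by apply: eq_allpairs => j i; rewrite zext2_tnth.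
rewrite negb_and => /orP[nQ|nP].
  by rewrite zext2_outl // memtE vE mem_filter (negPf nQ).
by rewrite zext2_outr // memtE uE mem_filter (negPf nP).
Qed.

End ZeroExtension2.

(** The list [u] is the base point followed by the support of [a]. The base point is kept although
    its part is 0, because it labels row or column 0 of the matrices; the head [x] is arbitrary
    since the sum prescribed there depends on [n]. *)
Lemma pointed_support (I : finType) (i0 : I) (a : I -> nat)
    (alpha := val (hat [seq a i | i <- enum I])) :
  (exists t, enum I = i0 :: t) -> a i0 = 0%N ->
  exists (u : (size alpha).+1.-tuple I) (P : pred I),
  [/\ u = [seq i <- enum I | P i] :> seq I, tnth u ord0 = i0,
      forall i, i \notin u -> i != i0 /\ a i = 0%N &
      forall x j, j != ord0 -> nth 0%N (x :: alpha) j = a (tnth u j)].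
Proof.
move=> [t It] a0; have Iuniq := enum_uniq I; rewrite It /= in Iuniq.
have alphaE : alpha = [seq a i | i <- t & (0 < a i)%N].
  by rewrite /alpha val_hat It /= a0 /= filter_map.
pose w := i0 :: [seq i <- t | (0 < a i)%N].
have sz_w : size w == (size alpha).+1 by rewrite alphaE size_map.
exists (Tuple sz_w), (fun i => (i == i0) || (0 < a i)%N); split.
- rewrite It /= eqxx /=; congr cons; apply: eq_in_filter => i it.
  case: eqP => // eq_i; case/andP: Iuniq; by rewrite -eq_i it.
- by rewrite (tnth_nth i0).
- move=> i; rewrite memtE /= inE negb_or mem_filter => /andP[ne_i].
  have : i \in enum I by rewrite mem_enum.
  by rewrite It inE (negPf ne_i) /= => ->; rewrite andbT -eqn0Ngt => /eqP.
- move=> x [[//|j] lt_j] _ /=; rewrite (tnth_nth i0) /= alphaE.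
  by rewrite (nth_map i0) //; move: lt_j; rewrite /= ltnS alphaE size_map.
Qed.

Lemma sumn_hat (I : finType) (a : I -> nat) :
  sumn (val (hat [seq a i | i <- enum I])) = (\sum_i a i)%N.
Proof.
rewrite val_hat sumnE big_filter big_map -big_enum big_mkcond /=.
by apply: eq_bigr => i _; case: (a i).
Qed.

Section Product.
Variables (I J : finType) (i0 : I) (j0 : J) (a : I -> nat) (b : J -> nat).
Hypotheses (I_head : exists t, enum I = i0 :: t).
Hypotheses (J_head : exists t, enum J = j0 :: t).
Hypotheses (a0 : a i0 = 0%N) (b0 : b j0 = 0%N).

Local Notation alpha := (hat [seq a i | i <- enum I]).
Local Notation beta := (hat [seq b j | j <- enum J]).

(** A row or column off the base point whose prescribed sum is 0 vanishes, so an array is determined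
    by its restriction to [v] and [u]. Fixing its total to be [n] amounts to prescribing the sums of
    row 0 and column 0. *)
Lemma heis_matrices_marginals n :
  (\sum_i a i <= n)%N -> (\sum_j b j <= n)%N ->
  \sum_(M in heis_matrices (val alpha) (val beta) n) X k (mx_reading M) =
  \sum_(M \in marginals i0 j0 a b `&` [set M | (\sum_p M p)%N = n]) Xw k M.
Proof.
move=> le_an le_bn.
have [u [P [uE u0 uout nth_a]]] := pointed_support I_head a0.
have [v [Q [vE v0 vout nth_b]]] := pointed_support J_head b0.
have u_uniq : uniq u by rewrite uE filter_uniq ?enum_uniq.
have v_uniq : uniq v by rewrite vE filter_uniq ?enum_uniq.
have neq0 (T : finType) m (w : m.+1.-tuple T) j : uniq w ->
    (tnth w j != tnth w ord0) = (j != ord0).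
  by move=> /tuple_uniqP w_inj; rewrite (inj_eq w_inj).
rewrite bigfs ?index_enum_uniq //; last by move=> i _; rewrite mem_index_enum.
pose h (M : 'M['I_n.+1]_((size (val beta)).+1, (size (val alpha)).+1)) :=
  zext2 u v (fun j i => M j i).
pose g (f : J * I -> nat) :
  'M['I_n.+1]_((size (val beta)).+1, (size (val alpha)).+1) :=
  \matrix_(j, i) inord (f (tnth v j, tnth u i)).
apply: (fsbig_bij (h := h) (g := g)) => [M|f [mf tot_f]].
  rewrite /= inE => /and3P[/eqP M00 /forallP Mcol /forallP Mrow].
  split; last by rewrite (Xw_zext2 _ _ _ uE vE).
  - split=> [|/=]; first split.
    + by rewrite -u0 -v0 /h zext2_tnth.
    + move=> i; have [[i' ->]|iu _] := zextP u i.
        rewrite -u0 neq0 // => ne_i'; rewrite /h sum_zext2_col //.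
        rewrite -(nth_a (n - sumn (val alpha))%N) //.
        by apply/eqP/Mcol.
      by rewrite (uout _ iu).2 big1 // => j _; rewrite /h zext2_outr.
    + move=> j; have [[j' ->]|jv _] := zextP v j.
        rewrite -v0 neq0 // => ne_j'; rewrite /h sum_zext2_row //.
        rewrite -(nth_b (n - sumn (val beta))%N) //.
        by apply/eqP/Mrow.
      by rewrite (vout _ jv).2 big1 // => i _; rewrite /h zext2_outl.
    (* Row 0 contributes [n] minus the sum of [b] and the other rows contribute the sum of [b];
       [le_bn] makes the truncated subtraction exact. *)
    + rewrite sum_pair (sum_tnth v_uniq) => [|j jv]; last first.
        by rewrite big1 // => i _; rewrite /h zext2_outl.
      rewrite big_ord_recl /h sum_zext2_row // (eqP (Mrow _)) /= sumn_hat.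
      rewrite -[RHS](subnK le_bn); congr addn.
      rewrite -sumn_hat sumnE (big_nth 0%N) big_mkord; apply: eq_bigr => j _.
      by rewrite sum_zext2_row // (eqP (Mrow _)).
  - by apply/matrixP => j i; rewrite mxE /h zext2_tnth // inord_val.
have [f00 fcol frow] := mf.
have le_fn p : (f p <= n)%N by rewrite -tot_f (bigD1 p) //= leq_addr.
have gE j i : g f j i = f (tnth v j, tnth u i) :> nat.
  by rewrite mxE inordK // ltnS.
have fu j i : i \notin u -> f (j, i) = 0%N.
  move=> /uout[/fcol + ai0]; rewrite ai0 => /eqP.
  by rewrite sum_nat_eq0 => /forallP/(_ j)/eqP.
have fv j i : j \notin v -> f (j, i) = 0%N.
  move=> /vout[/frow + bj0]; rewrite bj0 => /eqP.
  by rewrite sum_nat_eq0 => /forallP/(_ i)/eqP.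
split; last first.
  rewrite -[RHS](zext2K u_uniq v_uniq) // /h; congr zext2.
  by apply: funext => j; apply: funext => i; rewrite gE.
rewrite /= inE; apply/and3P; split.
- by rewrite gE u0 v0 f00.
- apply/forallP => i.
  have -> : (\sum_j g f j i = \sum_j f (j, tnth u i))%N.
    rewrite (sum_tnth v_uniq) => [|j jv]; last exact: fv.
    by apply: eq_bigr => j _; rewrite gE.
  have [->|ne_i] := eqVneq i ord0; last by rewrite nth_a // fcol // -u0 neq0.
  by rewrite /= u0 sumn_hat -tot_f -(marginals_col a0 mf) addnK.
- apply/forallP => j.
  have -> : (\sum_i g f j i = \sum_i f (tnth v j, i))%N.
    rewrite (sum_tnth u_uniq) => [|i iu]; last exact: fu.
    by apply: eq_bigr => i _; rewrite gE.
  have [->|ne_j] := eqVneq j ord0; last by rewrite nth_b // frow // -v0 neq0.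
  by rewrite /= v0 sumn_hat -tot_f -(marginals_row b0 mf) addnK.
Qed.

(** The size [n] of a matrix is its total, so the outer sum over [n] is absorbed; by
    [marginals_total] its range misses no array. *)
Lemma heis_Xw :
  heis (Xw k a) (Xw k b) = \sum_(M \in marginals i0 j0 a b) Xw k M.
Proof.
rewrite [in LHS]/Xw heisXX /heisX !sumn_hat.
rewrite fsbig_seq ?iota_uniq //.
have finm := finite_marginals i0 j0 a b.
transitivity (\sum_(n \in [set` index_iota (maxn (\sum_i a i) (\sum_j b j))
                                (\sum_i a i + \sum_j b j).+1])
  \sum_(M \in marginals i0 j0 a b `&` [set M | (\sum_p M p)%N = n]) Xw k M).
  apply: eq_fsbig_set => n /=; rewrite mem_index_iota geq_max => /andP[/andP[an bn] _].
  exact: heis_matrices_marginals.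
rewrite pair_fsbig_dep => [||n _]; [|exact: finite_seq|exact: finite_setIl].
apply: (fsbig_bij (h := snd) (g := fun M => ((\sum_p M p)%N, M))).
  by move=> [n M] /= [_ [mM <-]].
move=> M mM; split=> //=; split=> //=.
rewrite mem_index_iota ltnS; exact: (marginals_total a0 b0 mM).
Qed.

End Product.

End HeisenbergFormula.

(** * Linear and bilinear maps on tensor products *)

Section Linearity.
Variable k : fieldType.

Lemma linear_comp_fun (U V W : lmodType k) (f : U -> V) (g : V -> W) :
  linear f -> linear g -> linear (g \o f).
Proof. by move=> lf lg c x y; rewrite /= lf lg. Qed.

Lemma linear_idfun (U : lmodType k) : linear (id : U -> U).
Proof. by []. Qed.

Lemma bilinear_comp (U U' V V' W : lmodType k) (f : U -> U') (g : V -> V')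
    (b : U' -> V' -> W) :
  linear f -> linear g -> bilinear_for *:%R *:%R b ->
  bilinear_for *:%R *:%R (fun u v => b (f u) (g v)).
Proof.
move=> lf lg bb; split=> [v c u u'|u c v v'] /=.
  by rewrite lf (bb.1 (g v)).
by rewrite lg (bb.2 (f u)).
Qed.

Lemma bilinear_swap (U V W : lmodType k) (b : U -> V -> W) :
  bilinear_for *:%R *:%R b -> bilinear_for *:%R *:%R (fun v u => b u v).
Proof. by move=> bb; split=> [u|v] c x y /=; rewrite (bb.1, bb.2). Qed.

Lemma eq_tensor_lift (U V W : lmodType k) (b b' : U -> V -> W) t :
  b =2 b' -> tensor_lift b t = tensor_lift b' t.
Proof. by move=> eq_b; apply: eq_bigr => p _; rewrite eq_b. Qed.

(** All three lifts are finite sums over the same representative of [t]. This yields linearity in a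
    parameter on which the lifted function depends. *)
Lemma tensor_lift_lcomb (U V W : lmodType k) (c : k) (b b' : U -> V -> W) t :
  tensor_lift (fun u v => c *: b u v + b' u v) t =
  c *: tensor_lift b t + tensor_lift b' t.
Proof.
rewrite /tensor_lift /malg_lift scaler_sumr -big_split; apply: eq_bigr => p _ /=.
by rewrite scalerDr !scalerA mulrC.
Qed.

Lemma tensor_map_linear (V V' W W' : lmodType k) (f : V -> V') (g : W -> W') :
  linear f -> linear g -> linear (tensor_map f g).
Proof.
by move=> lf lg; apply/tensor_lift_linear/bilinear_comp => //; apply: tens_bilinear.
Qed.

Lemma tensor_map_tens (V V' W W' : lmodType k) (f : V -> V') (g : W -> W') v w :
  linear f -> linear g -> tensor_map f g (v ⊗ w) = f v ⊗ g w.
Proof.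
by move=> lf lg; apply/tensor_liftE/bilinear_comp => //; apply: tens_bilinear.
Qed.

Lemma tensor_swap_linear (V W : lmodType k) : linear (@tensor_swap k V W).
Proof. exact/tensor_lift_linear/bilinear_swap/tens_bilinear. Qed.

Lemma tens_assoc_bilinear (U V W : lmodType k) (w : W) :
  bilinear_for *:%R *:%R (fun (u : U) (v : V) => u ⊗ (v ⊗ w)).
Proof.
apply: (bilinear_comp (f := id) (g := fun v => v ⊗ w)) => //.
  exact: (tens_bilinear V W).1.
exact: tens_bilinear.
Qed.

Lemma tensor_assoc_bilinear (U V W : lmodType k) :
  bilinear_for *:%R *:%R (fun uv w =>
    tensor_lift (fun (u : U) (v : V) => u ⊗ (v ⊗ (w : W))) uv).
Proof.
split=> [w|uv c w w'] /=; first exact/tensor_lift_linear/tens_assoc_bilinear.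
rewrite -tensor_lift_lcomb; apply: eq_tensor_lift => u v.
by rewrite (tens_bilinear V W).2 (tens_bilinear U _).2.
Qed.

Lemma tensor_assoc_linear (U V W : lmodType k) : linear (@tensor_assoc k U V W).
Proof. exact/tensor_lift_linear/tensor_assoc_bilinear. Qed.

Lemma tensor_assoc_tens (U V W : lmodType k) (u : U) (v : V) (w : W) :
  tensor_assoc (u ⊗ v ⊗ w) = u ⊗ (v ⊗ w).
Proof.
rewrite /tensor_assoc tensor_liftE; last exact: tensor_assoc_bilinear.
by rewrite tensor_liftE //; apply: tens_assoc_bilinear.
Qed.

Section TensorMul.
Variables (V : lmodType k) (mu : V -> V -> V).
Hypothesis mu_bilin : bilinear_for *:%R *:%R mu.

Lemma tens_mul_bilinearr (a b : V) :
  bilinear_for *:%R *:%R (fun c d => mu a c ⊗ mu b d).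
Proof.
apply: (bilinear_comp (f := mu a) (g := mu b)).
- exact: mu_bilin.2.
- exact: mu_bilin.2.
- exact: tens_bilinear.
Qed.

Lemma tens_mul_bilinearl (t : tensor V V) :
  bilinear_for *:%R *:%R
    (fun a b => tensor_lift (fun c d => mu a c ⊗ mu b d) t).
Proof.
split=> [b x a a'|a x b b'] /=; rewrite -tensor_lift_lcomb;
    apply: eq_tensor_lift => c d.
  by rewrite (mu_bilin.1 c) (tens_bilinear V V).1.
by rewrite (mu_bilin.1 d) (tens_bilinear V V).2.
Qed.

Lemma tensor_mul_bilinear : bilinear_for *:%R *:%R (tensor_mul mu).
Proof.
split=> [t|s c t t'] /=; first exact/tensor_lift_linear/tens_mul_bilinearl.
rewrite /tensor_mul -tensor_lift_lcomb; apply: eq_tensor_lift => a b.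
exact/tensor_lift_linear/tens_mul_bilinearr.
Qed.

Lemma tensor_mul_tens a b c d :
  tensor_mul mu (a ⊗ b) (c ⊗ d) = mu a c ⊗ mu b d.
Proof.
rewrite /tensor_mul tensor_liftE; last exact: tens_mul_bilinearl.
by rewrite tensor_liftE //; apply: tens_mul_bilinearr.
Qed.

End TensorMul.

(** Every element is the combination of the [X] given by its coordinates; this reduces each axiom to
    basis elements. *)
Lemma Sigma_ext (U : lmodType k) (f g : Sigma k -> U) :
  linear f -> linear g -> (forall alpha, f (X k alpha) = g (X k alpha)) ->
  f =1 g.
Proof.
move=> lf lg fg x; rewrite -[x]coordK.
pose F : {linear Sigma k -> U} := HB.pack f (GRing.isLinear.Build k _ _ *:%R f lf).
pose G : {linear Sigma k -> U} := HB.pack g (GRing.isLinear.Build k _ _ *:%R g lg).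
rewrite -[f]/(F : _ -> _) -[g]/(G : _ -> _) !malg_lift_comp.
by apply: eq_bigr => alpha _; rewrite /= fg.
Qed.

Lemma heis_bilinear : bilinear_for *:%R *:%R (@heis k).
Proof.
split=> [y|x c y y'] /=; first exact: Sigma_lift_linear.
(* Only the outer lifts are unfolded, into sums over the coordinates of [x]; each term is linear in
   the second factor through the inner lift. *)
rewrite /heis {1 3 5}/Sigma_lift /malg_lift scaler_sumr -big_split.
apply: eq_bigr => alpha _ /=; rewrite Sigma_lift_linear.
by rewrite scalerDr !scalerA mulrC.
Qed.

Lemma SigmaDelta_linear : linear (@SigmaDelta k).
Proof. exact: Sigma_lift_linear. Qed.

Lemma Sigma_eps_linear : linear (@Sigma_eps k : Sigma k -> k^o).
Proof. exact: Sigma_lift_linear. Qed.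

End Linearity.

(** * Coalgebra structure *)

Section SplitSums.
Variables (I : finType) (a : I -> nat).

Lemma splits_swap (V : nmodType) (F : (I -> nat) -> (I -> nat) -> V) :
  \sum_(p \in splits a) F p.1 p.2 = \sum_(p \in splits a) F p.2 p.1.
Proof.
apply: (fsbig_bij (h := fun p => (p.2, p.1)) (g := fun p => (p.2, p.1)));
by move=> [b c] /= bc; split=> // i /=; rewrite addnC bc.
Qed.

(** Both sides sum over ordered triples with sum [a]: the intermediate term of each iterated split
    is the sum of two members of the triple. *)
Lemma splits_assoc (V : nmodType)
    (F : (I -> nat) -> (I -> nat) -> (I -> nat) -> V) :
  \sum_(p \in splits a) \sum_(q \in splits p.1) F q.1 q.2 p.2 =
  \sum_(p \in splits a) \sum_(q \in splits p.2) F p.1 q.1 q.2.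
Proof.
rewrite !pair_fsbig_dep => [||p _||p _]; try exact: finite_splits.
pose h (r : ((I -> nat) * (I -> nat)) * ((I -> nat) * (I -> nat))) :=
  ((r.2.1, fun i => (r.2.2 i + r.1.2 i)%N), (r.2.2, r.1.2)).
pose g (r : ((I -> nat) * (I -> nat)) * ((I -> nat) * (I -> nat))) :=
  ((fun i => (r.1.1 i + r.2.1 i)%N, r.2.2), (r.1.1, r.2.1)).
apply: (fsbig_bij (h := h) (g := g)) => [[[p1 p2] [q1 q2]] [/= p q]|].
  split=> //; last by rewrite /g /h /=; congr (_, _, _); apply: funext.
  by split=> // i /=; rewrite addnA q p.
move=> [[p1 p2] [q1 q2]] [/= p q]; split.
  by split=> // i /=; rewrite -addnA q p.
by rewrite /g /h /=; congr (_, _, _); apply: funext.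
Qed.

End SplitSums.

Section Counit.
Variable k : fieldType.

Lemma Sigma_eps_Xw (I : finType) (a : I -> nat) :
  Sigma_eps (Xw k a) = [forall i, a i == 0%N]%:R.
Proof.
rewrite Sigma_eps_X val_hat; congr (nat_of_bool _)%:R.
rewrite -size_eq0 size_filter -leqn0 leqNgt -has_count.
apply/hasPn/forallP => [a0 i|a0 _ /mapP[i _ ->]]; last by rewrite (eqP (a0 i)).
by rewrite eqn0Ngt a0 // map_f // mem_enum.
Qed.

(** Only the split [(0, a)] survives. A general [F] serves both the counit axioms and the unit of
    convolution. *)
Lemma splits_counitl (V : lmodType k) (I : finType) (a : I -> nat)
    (F : (I -> nat) -> V) :
  \sum_(p \in splits a) Sigma_eps (Xw k p.1) *: F p.2 = F a.
Proof.
rewrite (fsbigD1 (fun=> 0%N, a)); [|exact: finite_splits|by []].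
rewrite fsbig1 /= => [|[b c] [/= bc ne]].
  rewrite addr0 Sigma_eps_Xw; case: forallP => [_|[]//].
  by rewrite scale1r.
rewrite Sigma_eps_Xw; case: forallP => [b0|_]; last by rewrite scale0r.
have b0' i : b i = 0%N by apply/eqP.
case: ne; congr (_, _); apply: funext => i //.
by have /= := bc i; rewrite b0'.
Qed.

Lemma SigmaDelta_lift (U : lmodType k) (b : Sigma k -> Sigma k -> U)
    (I : finType) (a : I -> nat) : bilinear_for *:%R *:%R b ->
  tensor_lift b (SigmaDelta (Xw k a)) =
  \sum_(p \in splits a) b (Xw k p.1) (Xw k p.2).
Proof.
move=> bb; rewrite SigmaDelta_Xw (fsbig_linear _ (tensor_lift_linear bb)).
  by apply: eq_fsbig_set => p _; rewrite tensor_liftE.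
exact: finite_splits.
Qed.

Lemma counit_bilinear :
  bilinear_for *:%R *:%R (fun u v : Sigma k => Sigma_eps u *: v).
Proof.
split=> [v c u u'|u c v v'] /=.
  by rewrite Sigma_eps_linear scalerDl scalerA.
by rewrite scalerDr !scalerA mulrC.
Qed.

Lemma Sigma_counitl x :
  tensor_lift (fun u v => Sigma_eps u *: v) (SigmaDelta x) = x :> Sigma k.
Proof.
have lin := tensor_lift_linear counit_bilinear.
move: x; apply: Sigma_ext => [||alpha]; last 1 first.
- by rewrite X_Xw SigmaDelta_lift ?splits_counitl //; apply: counit_bilinear.
- exact: linear_comp_fun (@SigmaDelta_linear k) lin.
- exact: linear_idfun.
Qed.

Lemma Sigma_cocommutative : cocommutative (@SigmaDelta k).
Proof.
apply: Sigma_ext => [||alpha].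
- exact: linear_comp_fun (@SigmaDelta_linear k) (@tensor_swap_linear k _ _).
- exact: SigmaDelta_linear.
rewrite X_Xw /tensor_swap SigmaDelta_lift; last exact/bilinear_swap/tens_bilinear.
rewrite SigmaDelta_Xw.
exact/esym/(splits_swap _ (fun b c => Xw k b ⊗ Xw k c)).
Qed.

Lemma Sigma_counitr x :
  tensor_lift (fun u v => Sigma_eps v *: u) (SigmaDelta x) = x :> Sigma k.
Proof.
(* By cocommutativity, the right counit law is the left one with the two tensor factors swapped. *)
rewrite -[RHS]Sigma_counitl -[in RHS]Sigma_cocommutative.
move: x; apply: Sigma_ext => [||alpha].
- exact: linear_comp_fun (@SigmaDelta_linear k)
    (tensor_lift_linear (bilinear_swap counit_bilinear)).
- exact: linear_comp_fun (linear_comp_fun (@SigmaDelta_linear k)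
    (@tensor_swap_linear k _ _)) (tensor_lift_linear counit_bilinear).
rewrite Sigma_cocommutative X_Xw !SigmaDelta_lift.
- exact/esym/(splits_swap _ (fun b c => Sigma_eps (Xw k b) *: Xw k c)).
- exact: counit_bilinear.
- exact/bilinear_swap/counit_bilinear.
Qed.

(** On a basis element both sides expand to the sum over ordered triples of weak compositions adding
    up to [a], and [splits_assoc] identifies them. *)
Lemma Sigma_coassoc (x : Sigma k) :
  tensor_assoc (tensor_map (@SigmaDelta k) id (SigmaDelta x)) =
  tensor_map id (@SigmaDelta k) (SigmaDelta x).
Proof.
have lD := @SigmaDelta_linear k; have lI := @linear_idfun k (Sigma k).
have lDI := tensor_map_linear lD lI; have lID := tensor_map_linear lI lD.
have lA := @tensor_assoc_linear k (Sigma k) (Sigma k) (Sigma k).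
move: x; apply: Sigma_ext => [||alpha].
- exact: linear_comp_fun (linear_comp_fun lD lDI) lA.
- exact: linear_comp_fun lD lID.
pose a (i : 'I_(size (val alpha))) := nth 0%N (val alpha) i.
rewrite X_Xw -/a SigmaDelta_Xw.
transitivity (\sum_(p \in splits a) \sum_(q \in splits p.1)
    Xw k q.1 ⊗ (Xw k q.2 ⊗ Xw k p.2)).
  rewrite (fsbig_linear _ lDI (finite_splits _)).
  rewrite (fsbig_linear (fun p => tensor_map (@SigmaDelta k) id (_ p.1 ⊗ _ p.2))
    lA (finite_splits _)).
  apply: eq_fsbig_set => p _; rewrite /= tensor_map_tens // SigmaDelta_Xw.
  have lp := linear_comp_fun ((tens_bilinear (tensor _ _) _).1 (Xw k p.2)) lA.
  rewrite [LHS](fsbig_linear (fun q => Xw k q.1 ⊗ Xw k q.2) lp (finite_splits _)).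
  by apply: eq_fsbig_set => q _; apply: tensor_assoc_tens.
apply: etrans (splits_assoc a (fun b c d => Xw k b ⊗ (Xw k c ⊗ Xw k d))) _.
rewrite [RHS](fsbig_linear (fun p => Xw k p.1 ⊗ Xw k p.2) lID (finite_splits _)).
apply: eq_fsbig_set => p _; rewrite tensor_map_tens // SigmaDelta_Xw.
have lp := (tens_bilinear (Sigma k) (tensor (Sigma k) (Sigma k))).2 (Xw k p.1).
by rewrite [RHS](fsbig_linear (fun q => Xw k q.1 ⊗ Xw k q.2) lp (finite_splits _)).
Qed.

Lemma Sigma_is_coalgebra : is_coalgebra (@SigmaDelta k) (@Sigma_eps k).
Proof.
split.
- exact: SigmaDelta_linear.
- exact: Sigma_eps_linear.
- exact: Sigma_coassoc.
- exact: Sigma_counitl.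
- exact: Sigma_counitr.
Qed.

End Counit.

(** * Bialgebra structure *)

Section Bialgebra.
Variable k : fieldType.

(** The extra leading zero provides the base point that [heis_Xw] requires. *)
Lemma X_Xw0 (alpha : composition) :
  X k alpha =
  Xw k (fun i : 'I_(size (val alpha)).+1 => nth 0%N (0%N :: val alpha) i).
Proof.
rewrite X_Xw; congr X; apply: val_inj; rewrite !val_hat enum_ordSl /=.
by rewrite -map_comp.
Qed.

Lemma enum_ord_head n : exists t, enum 'I_n.+1 = ord0 :: t.
Proof. by rewrite enum_ordSl; eexists. Qed.

Lemma enum_prod_head (I J : finType) (i0 : I) (j0 : J) :
  (exists t, enum I = i0 :: t) -> (exists t, enum J = j0 :: t) ->
  exists t, enum {: J * I} = (j0, i0) :: t.
Proof. by move=> [s sE] [t tE]; rewrite enum_prod sE tE; eexists. Qed.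

Lemma splits0 (I : finType) (a : I -> nat) p i :
  splits a p -> a i = 0%N -> p.1 i = 0%N /\ p.2 i = 0%N.
Proof.
by move=> /(_ i) <- /eqP; rewrite addn_eq0 => /andP[/eqP-> /eqP->].
Qed.

(** * Bijections between arrays with prescribed marginals *)

Section Pointed.
Variables (I J L : finType) (i0 : I) (j0 : J) (l0 : L).
Variables (a : I -> nat) (b : J -> nat) (c : L -> nat).

Local Notation T1 := ((J * I -> nat) * (L * (J * I) -> nat))%type.
Local Notation T2 := ((L * J -> nat) * ((L * J) * I -> nat))%type.

(** Both sides sum over arrays on the triple product that vanish at the base point and have sums
    [a], [b], [c] along their slices off it. The intermediate matrix [m] is forced, being a
    two-dimensional marginal of the array. *)
Lemma marginals_assoc (V : nmodType) (F : ((L * J) * I -> nat) -> V) :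
  \sum_(m \in marginals i0 j0 a b)
    \sum_(M \in marginals (j0, i0) l0 m c) F (fun p => M (p.1.1, (p.1.2, p.2))) =
  \sum_(m \in marginals j0 l0 b c) \sum_(M \in marginals i0 (l0, j0) a m) F M.
Proof.
have finm := finite_marginals.
rewrite !pair_fsbig_dep => [||m _||m _]; try exact: finm.
(* The marginal is reset to 0 at the base point, where [marginals] demands 0 although the line sum
   of the array there may be positive. *)
pose h (r : T1) : T2 :=
  ((fun p => if p == (l0, j0) then 0%N else (\sum_i r.2 (p.1, (p.2, i)))%N),
   (fun p => r.2 (p.1.1, (p.1.2, p.2)))).
pose g (r : T2) : T1 :=
  ((fun p => if p == (j0, i0) then 0%N else (\sum_l r.2 ((l, p.1), p.2))%N),
   (fun p => r.2 ((p.1, p.2.1), p.2.2))).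
apply: (fsbig_bij (h := h) (g := g)) => [[m M]|[m M]] /= [[/= m0 ma mb] [/= M0 Ma Mb]].
- have mE j i : (j, i) != (j0, i0) -> m (j, i) = (\sum_l M (l, (j, i)))%N.
    by move=> /Ma.
  split=> //; last first.
    congr (_, _); apply: funext => p; rewrite /h /=.
      by case: eqP => [->//|/eqP]; case: p => j i /mE.
    by case: p => l [].
  split=> /=; split=> //=.
  + by rewrite eqxx.
  + move=> j ne_j; rewrite -mb //.
    under eq_bigr do rewrite xpair_eqE (negPf ne_j) andbF.
    rewrite exchange_big; apply: eq_bigr => i _.
    by rewrite mE // xpair_eqE (negPf ne_j).
  + move=> l ne_l; rewrite -Mb // sum_pair.
    by apply: eq_bigr => j _; rewrite xpair_eqE (negPf ne_l).
  + move=> i ne_i; rewrite -ma // sum_pair exchange_big; apply: eq_bigr => j _.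
    by rewrite mE // xpair_eqE (negPf ne_i) andbF.
  + by move=> [l j] /negPf ne; rewrite ne.
have mE l j : (l, j) != (l0, j0) -> m (l, j) = (\sum_i M ((l, j), i))%N.
  by move=> /Mb.
split; last first.
  congr (_, _); apply: funext => p; rewrite /g /=.
    by case: eqP => [->//|/eqP]; case: p => l j /mE.
  by case: p => [[]].
split=> /=; split=> //=.
+ by rewrite eqxx.
+ move=> i ne_i; rewrite -Ma // sum_pair [RHS]exchange_big; apply: eq_bigr => j _.
  by rewrite xpair_eqE (negPf ne_i) andbF.
+ move=> j ne_j; rewrite -ma //.
  under eq_bigr do rewrite xpair_eqE (negPf ne_j).
  rewrite exchange_big; apply: eq_bigr => l _.
  by rewrite mE // xpair_eqE (negPf ne_j) andbF.
+ by move=> [j i] /negPf ne; rewrite ne.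
+ move=> l ne_l; rewrite -mb // sum_pair; apply: eq_bigr => j _.
  by rewrite mE // xpair_eqE (negPf ne_l).
Qed.

(** Both bracketings enumerate the triples lexicographically. *)
Lemma Xw_assoc (M : L * (J * I) -> nat) :
  Xw k M = Xw k (fun p : (L * J) * I => M (p.1.1, (p.1.2, p.2))).
Proof.
congr (X k (hat _)); rewrite !enum_prod !map_allpairs.
elim: (enum L) => //= l s IHs; by rewrite flatten_cat -IHs map_allpairs.
Qed.

(** Splitting an array into two splits its marginals accordingly; conversely, two arrays whose
    marginals add up to [a] and [b] have a sum with these marginals. This is the compatibility of
    product and coproduct. *)
Lemma marginals_splits (V : nmodType) (F : (J * I -> nat) -> (J * I -> nat) -> V) :
  a i0 = 0%N -> b j0 = 0%N ->
  \sum_(M \in marginals i0 j0 a b) \sum_(p \in splits M) F p.1 p.2 =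
  \sum_(p \in splits a) \sum_(q \in splits b)
    \sum_(M \in marginals i0 j0 p.1 q.1)
      \sum_(N \in marginals i0 j0 p.2 q.2) F M N.
Proof.
move=> a0 b0; have finm := finite_marginals i0 j0.
rewrite pair_fsbig_dep //; last by move=> M _; exact: finite_splits.
rewrite pair_fsbig; [|exact: finite_splits|exact: finite_splits].
under eq_fsbigr => pq _ do rewrite pair_fsbig //.
have fins : finite_set (splits a `*` splits b).
  by apply: finite_setX; exact: finite_splits.
rewrite pair_fsbig_dep //; last by move=> pq _; apply: finite_setX.
(* The value at the base point is 0 because the splits of [a] vanish where [a] does, while the base
   column itself may have a nonzero sum. *)
pose col (M : J * I -> nat) i := if i == i0 then 0%N else (\sum_j M (j, i))%N.
pose row (M : J * I -> nat) j := if j == j0 then 0%N else (\sum_i M (j, i))%N.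
pose h (r : (J * I -> nat) * ((J * I -> nat) * (J * I -> nat))) :=
  (((col r.2.1, col r.2.2), (row r.2.1, row r.2.2)), r.2).
pose g (r : ((I -> nat) * (I -> nat) * ((J -> nat) * (J -> nat)))
            * ((J * I -> nat) * (J * I -> nat))) :=
  ((fun p => (r.2.1 p + r.2.2 p)%N), r.2).
have colE M x y : x i0 = 0%N -> marginals i0 j0 x y M -> col M = x.
  move=> x0 [_ Mx _]; apply: funext => i; rewrite /col.
  by case: eqP => [->//|/eqP/Mx].
have rowE M x y : y j0 = 0%N -> marginals i0 j0 x y M -> row M = y.
  move=> y0 [_ _ My]; apply: funext => j; rewrite /row.
  by case: eqP => [->//|/eqP/My].
apply: (fsbig_bij (h := h) (g := g)).
  move=> [M [M1 M2]] [/= [M0 Ma Mb] MM]; split=> //.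
    split; first (split=> /=).
    - move=> i /=; rewrite /col; case: eqP => [->//|/eqP/Ma <-].
      by rewrite -big_split; apply: eq_bigr => j _; rewrite -MM.
    - move=> j /=; rewrite /row; case: eqP => [->//|/eqP/Mb <-].
      by rewrite -big_split; apply: eq_bigr => i _; rewrite -MM.
    - by split=> /=; split; rewrite /col /row; try (by move=> i /negPf->);
        have /= := MM (j0, i0); rewrite M0; lia.
  by rewrite /g /=; congr (_, _); apply: funext.
move=> [[[a1 a2] [b1 b2]] [M1 M2]] [[/= sa sb] [/= m1 m2]].
have /= [a10 a20] := splits0 sa a0.
have /= [b10 b20] := splits0 sb b0.
split; last first.
  by rewrite /h /= (colE _ _ _ a10 m1) (colE _ _ _ a20 m2)
    (rowE _ _ _ b10 m1) (rowE _ _ _ b20 m2).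
case: m1 m2 => [M10 M1a M1b] [M20 M2a M2b]; split=> //=; split=> /=.
- by rewrite M10 M20.
- by move=> i ne_i; rewrite big_split M1a // M2a.
- by move=> j ne_j; rewrite big_split M1b // M2b.
Qed.

End Pointed.

(** An array in a partial product vanishes at the pair of base points, which comes first in the
    enumeration, so [heis_Xw] applies a second time. *)
Lemma heis_Xw_assoc (I J L : finType) (i0 : I) (j0 : J) (l0 : L)
    (a : I -> nat) (b : J -> nat) (c : L -> nat) :
  (exists t, enum I = i0 :: t) -> (exists t, enum J = j0 :: t) ->
  (exists t, enum L = l0 :: t) ->
  a i0 = 0%N -> b j0 = 0%N -> c l0 = 0%N ->
  heis (Xw k a) (heis (Xw k b) (Xw k c)) = heis (heis (Xw k a) (Xw k b)) (Xw k c).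
Proof.
move=> hI hJ hL a0 b0 c0; have hb := heis_bilinear k.
rewrite (heis_Xw k hI hJ a0 b0) (heis_Xw k hJ hL b0 c0).
rewrite (fsbig_linear _ (hb.2 (Xw k a)) (finite_marginals _ _ _ _)).
rewrite (fsbig_linear _ (hb.1 (Xw k c)) (finite_marginals _ _ _ _)).
transitivity (\sum_(m \in marginals j0 l0 b c)
    \sum_(M \in marginals i0 (l0, j0) a m) Xw k M).
  apply: eq_fsbig_set => m [m0 _ _].
  by rewrite (heis_Xw k hI (enum_prod_head hJ hL) a0 m0).
rewrite -(marginals_assoc _ _ _ _ _ _ (fun M => Xw k M)).
apply: eq_fsbig_set => m [m0 _ _].
rewrite (heis_Xw k (enum_prod_head hI hJ) hL m0 c0).
by apply: eq_fsbig_set => M _; rewrite [RHS]Xw_assoc.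
Qed.

Lemma heis_assoc : associative (@heis k).
Proof.
move=> x y z; have hb := heis_bilinear k.
move: x; apply: Sigma_ext => [||alpha]; first exact: (hb.1 (heis y z)).
  exact: linear_comp_fun (hb.1 y) (hb.1 z).
move: y; apply: Sigma_ext => [||beta].
- exact: linear_comp_fun (hb.1 z) (hb.2 _).
- exact: linear_comp_fun (hb.2 _) (hb.1 z).
move: z; apply: Sigma_ext => [||gamma].
- exact: linear_comp_fun (hb.2 _) (hb.2 _).
- exact: hb.2.
rewrite !X_Xw0; have hI := @enum_ord_head.
by apply: heis_Xw_assoc (hI _) (hI _) (hI _) _ _ _.
Qed.

Lemma SigmaDelta_heis x y :
  SigmaDelta (heis x y) =
  tensor_mul (@heis k) (SigmaDelta x) (SigmaDelta y).
Proof.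
have hb := heis_bilinear k; have lD := @SigmaDelta_linear k.
have tb := tensor_mul_bilinear hb.
move: x; apply: Sigma_ext => [||alpha].
- exact: linear_comp_fun (hb.1 y) lD.
- exact: linear_comp_fun lD (tb.1 _).
move: y; apply: Sigma_ext => [||beta].
- exact: linear_comp_fun (hb.2 _) lD.
- exact: linear_comp_fun lD (tb.2 _).
pose a (i : 'I_(size (val alpha)).+1) := nth 0%N (0%N :: val alpha) i.
pose b (i : 'I_(size (val beta)).+1) := nth 0%N (0%N :: val beta) i.
rewrite !X_Xw0 -/a -/b; have hI := @enum_ord_head.
have a0 : a ord0 = 0%N by []; have b0 : b ord0 = 0%N by [].
rewrite (heis_Xw k (hI _) (hI _) a0 b0).
rewrite [LHS](fsbig_linear (fun M => Xw k M) lD (finite_marginals _ _ _ _)).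
under eq_fsbigr do rewrite SigmaDelta_Xw.
apply: etrans (marginals_splits (fun M N => Xw k M ⊗ Xw k N) a0 b0) _.
rewrite !SigmaDelta_Xw.
rewrite [RHS](fsbig_linear (fun p => Xw k p.1 ⊗ Xw k p.2) (tb.1 _) (finite_splits _)).
apply: eq_fsbig_set => p pa.
rewrite [RHS](fsbig_linear (fun q => Xw k q.1 ⊗ Xw k q.2) (tb.2 _) (finite_splits _)).
apply: eq_fsbig_set => q qb.
have /= [p10 p20] := splits0 pa a0.
have /= [q10 q20] := splits0 qb b0.
rewrite tensor_mul_tens //.
rewrite (heis_Xw k (hI _) (hI _) p10 q10) (heis_Xw k (hI _) (hI _) p20 q20).
have bt := tens_bilinear (Sigma k) (Sigma k).
rewrite [RHS](fsbig_linear (fun M => Xw k M) (bt.1 _) (finite_marginals _ _ _ _)).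
apply: eq_fsbig_set => M _.
by rewrite [RHS](fsbig_linear (fun N => Xw k N) (bt.2 _) (finite_marginals _ _ _ _)).
Qed.

(** The counit sees only the zero array, which occurs in the product exactly when [a] and [b] are
    both zero. *)
Lemma Sigma_eps_heis x y :
  Sigma_eps (heis x y) = Sigma_eps x * Sigma_eps y :> k.
Proof.
have hb := heis_bilinear k; have le := @Sigma_eps_linear k.
move: x; apply: (@Sigma_ext k k^o) => [||alpha].
- exact: linear_comp_fun (hb.1 y) le.
- by move=> c u u'; rewrite le mulrDl; congr (_ + _); exact/esym/mulrA.
move: y; apply: (@Sigma_ext k k^o) => [||beta].
- exact: linear_comp_fun (hb.2 _) le.
- by move=> c u u'; rewrite le mulrDr; congr (_ + _); exact: mulrCA.
pose a (i : 'I_(size (val alpha)).+1) := nth 0%N (0%N :: val alpha) i.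
pose b (i : 'I_(size (val beta)).+1) := nth 0%N (0%N :: val beta) i.
rewrite !X_Xw0 -/a -/b; have hI := @enum_ord_head.
have a0 : a ord0 = 0%N by []; have b0 : b ord0 = 0%N by [].
rewrite (heis_Xw k (hI _) (hI _) a0 b0).
rewrite [LHS](fsbig_linear (V := k^o) (fun M => Xw k M) le (finite_marginals _ _ _ _)).
have epsN M : M <> (fun=> 0%N) -> Sigma_eps (Xw k M) = 0 :> k.
  move=> M0; rewrite Sigma_eps_Xw; case: forallP => // M0'; case: M0.
  by apply: funext => p; apply/eqP.
rewrite !Sigma_eps_Xw; have [/andP[/forallP a_0 /forallP b_0]|] :=
    boolP ([forall i, a i == 0%N] && [forall j, b j == 0%N]).
  rewrite (fsbigD1 (fun=> 0%N)); last 2 first.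
  - exact: finite_marginals.
  - split=> // i _; rewrite big1 //; apply/esym/eqP; [exact: a_0|exact: b_0].
  rewrite fsbig1 => [|M [_ /epsN]//].
  apply: etrans (addr0 _) _; rewrite Sigma_eps_Xw.
  by do 3![case: forallP => [_|[]//]]; rewrite mulr1.
move=> nab; rewrite fsbig1 => [|M [M0 Ma Mb]].
  by move: nab; do 2!case: forallP => _; rewrite ?mulr0 ?mul0r.
apply: epsN => M_0; case/negP: nab; rewrite M_0 in Ma Mb.
apply/andP; split; apply/forallP.
  by move=> i; have [->|/Ma <-] := eqVneq i ord0; rewrite ?a0 // big1.
by move=> j; have [->|/Mb <-] := eqVneq j ord0; rewrite ?b0 // big1.
Qed.

End Bialgebra.

(** * The unit *)

Section Unit.
Variable k : fieldType.

Lemma enum_unit : enum {: unit} = [:: tt].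
Proof. by rewrite enumT unlock. Qed.

Lemma enum_unit_head : exists t, enum {: unit} = tt :: t.
Proof. by rewrite enum_unit; eexists. Qed.

(** A single zero part is kept so that the unit too has a base point. *)
Lemma Sigma_one_Xw : Sigma_one = Xw k (fun _ : unit => 0%N).
Proof. by congr X; apply: val_inj; rewrite val_hat enum_unit. Qed.

(** The base column is the only column, so its entries are the row sums: the one admissible array is
    [b] itself. *)
Lemma heis_1l : left_id Sigma_one (@heis k).
Proof.
move=> x; have hb := heis_bilinear k.
move: x; apply: Sigma_ext => [||beta]; [exact: hb.2|exact: linear_idfun|].
pose b (j : 'I_(size (val beta)).+1) := nth 0%N (0%N :: val beta) j.
rewrite X_Xw0 -/b Sigma_one_Xw.
rewrite (heis_Xw k enum_unit_head (@enum_ord_head _) (erefl _) (erefl (b ord0))).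
rewrite (_ : marginals _ _ _ _ = [set fun p => b p.1]).
  rewrite fsbig_set1; congr (X k (hat _)); rewrite enum_prod map_allpairs /=.
  by rewrite enum_unit /= flatten_map1.
apply/seteqP; split=> [M [M0 _ Mb]|_ -> /=].
  apply: funext => -[j []]; have [->|/Mb <-] := eqVneq j ord0; first exact: M0.
  by rewrite (big_pred1 tt) // => -[].
by split=> // j _; rewrite (big_pred1 tt) // => -[].
Qed.

Lemma heis_1r : right_id Sigma_one (@heis k).
Proof.
move=> x; have hb := heis_bilinear k.
move: x; apply: Sigma_ext => [||alpha]; [exact: hb.1|exact: linear_idfun|].
pose a (i : 'I_(size (val alpha)).+1) := nth 0%N (0%N :: val alpha) i.
rewrite X_Xw0 -/a Sigma_one_Xw.
rewrite (heis_Xw k (@enum_ord_head _) enum_unit_head (erefl (a ord0)) (erefl _)).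
rewrite (_ : marginals _ _ _ _ = [set fun p => a p.2]).
  rewrite fsbig_set1; congr (X k (hat _)); rewrite enum_prod map_allpairs /=.
  by rewrite enum_unit /= cats0.
apply/seteqP; split=> [M [M0 Ma _]|_ -> /=].
  apply: funext => -[[] i]; have [->|/Ma <-] := eqVneq i ord0; first exact: M0.
  by rewrite (big_pred1 tt) // => -[].
by split=> // i _; rewrite (big_pred1 tt) // => -[].
Qed.

Lemma SigmaDelta_one :
  SigmaDelta Sigma_one = Sigma_one ⊗ Sigma_one :> tensor (Sigma k) _.
Proof.
rewrite Sigma_one_Xw SigmaDelta_Xw.
rewrite (_ : splits _ = [set (fun=> 0%N, fun=> 0%N)]) ?fsbig_set1 //.
apply/seteqP; split=> [[b c] bc|_ -> //].
by congr (_, _); apply: funext => i; have /= := splits0 bc (erefl : _ i = _); case.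
Qed.

Lemma Sigma_is_bialgebra :
  is_bialgebra (@heis k) Sigma_one (@SigmaDelta k) (@Sigma_eps k).
Proof.
split.
- split; [exact: heis_bilinear|exact: heis_assoc|exact: heis_1l|exact: heis_1r].
- exact: Sigma_is_coalgebra.
- exact: SigmaDelta_heis.
- exact: SigmaDelta_one.
- exact: Sigma_eps_heis.
- by rewrite Sigma_eps_X.
Qed.

End Unit.

(** * Antipode *)

Lemma linear_zero (R : pzRingType) (U V : lmodType R) (f : U -> V) :
  linear f -> f 0 = 0.
Proof.
by move=> lf; have := lf (-1) 0 0; rewrite scaleN1r oppr0 addr0 scaleN1r addNr.
Qed.

Lemma linear_scale (R : pzRingType) (U V : lmodType R) (f : U -> V) c x :
  linear f -> f (c *: x) = c *: f x.
Proof. by move=> lf; rewrite -[c *: x]addr0 lf linear_zero // !addr0. Qed.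

Section Antipode.
Variable k : fieldType.

Local Notation S := (Sigma k).

(** The convolution product, with unit [conv_unit]; an antipode is a two-sided convolution inverse
    of the identity. *)
Definition conv (f g : S -> S) (x : S) : S :=
  tensor_lift (fun u v => heis (f u) (g v)) (SigmaDelta x).

Definition conv_unit (x : S) : S := Sigma_eps x *: Sigma_one.

Lemma heis_comp_bilinear f g : linear f -> linear g ->
  bilinear_for *:%R *:%R (fun u v : S => heis (f u) (g v)).
Proof. by move=> lf lg; apply: bilinear_comp => //; apply: heis_bilinear. Qed.

Lemma conv_linear f g : linear f -> linear g -> linear (conv f g).
Proof.
move=> lf lg; have lb := tensor_lift_linear (heis_comp_bilinear lf lg).
exact: linear_comp_fun (@SigmaDelta_linear k) lb.
Qed.

Lemma conv_unit_linear : linear conv_unit.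
Proof.
by move=> c x y; rewrite /conv_unit Sigma_eps_linear scalerDl scalerA.
Qed.

Lemma conv_Xw f g (I : finType) (a : I -> nat) : linear f -> linear g ->
  conv f g (Xw k a) = \sum_(p \in splits a) heis (f (Xw k p.1)) (g (Xw k p.2)).
Proof. by move=> lf lg; apply: SigmaDelta_lift; apply: heis_comp_bilinear. Qed.

Lemma convA f g h : linear f -> linear g -> linear h ->
  conv (conv f g) h =1 conv f (conv g h).
Proof.
move=> lf lg lh; have hb := heis_bilinear k.
have lfg := conv_linear lf lg; have lgh := conv_linear lg lh.
apply: Sigma_ext => [||alpha]; [exact: conv_linear|exact: conv_linear|].
rewrite X_Xw !conv_Xw //; set a := (X in splits X).
transitivity (\sum_(p \in splits a) \sum_(q \in splits p.1)
    heis (heis (f (Xw k q.1)) (g (Xw k q.2))) (h (Xw k p.2))).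
  apply: eq_fsbig_set => p _; rewrite conv_Xw //.
  exact: (fsbig_linear (fun q => heis (f (Xw k q.1)) (g (Xw k q.2)))
    (hb.1 _) (finite_splits _)).
rewrite (splits_assoc a (fun b c d =>
  heis (heis (f (Xw k b)) (g (Xw k c))) (h (Xw k d)))).
apply: eq_fsbig_set => p _; rewrite conv_Xw //.
rewrite [RHS](fsbig_linear (fun q => heis (g (Xw k q.1)) (h (Xw k q.2)))
    (hb.2 _) (finite_splits _)).
by apply: eq_fsbig_set => q _; rewrite heis_assoc.
Qed.

Lemma conv1f f : linear f -> conv conv_unit f =1 f.
Proof.
move=> lf; have lu := conv_unit_linear.
apply: Sigma_ext => [||alpha] //; first exact: conv_linear.
rewrite X_Xw conv_Xw // -[RHS](splits_counitl _ (fun b => f (Xw k b))).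
apply: eq_fsbig_set => p _; rewrite -[in RHS](heis_1l (f _)).
exact: (linear_scale _ _ ((heis_bilinear k).1 _)).
Qed.

Lemma convf1 f : linear f -> conv f conv_unit =1 f.
Proof.
move=> lf; have lu := conv_unit_linear.
apply: Sigma_ext => [||alpha] //; first exact: conv_linear.
rewrite X_Xw conv_Xw // -[RHS](splits_counitl _ (fun b => f (Xw k b))).
(* Swapping the two halves of each split brings the counit to the left, where [splits_counitl]
   applies. *)
apply: etrans (splits_swap _ (fun b c => heis (f (Xw k b)) (conv_unit (Xw k c)))) _.
apply: eq_fsbig_set => p _; rewrite -[in RHS](heis_1r (f _)).
exact: (linear_scale _ _ ((heis_bilinear k).2 _)).
Qed.

Lemma eq_conv f f' g g' : f =1 f' -> g =1 g' -> conv f g =1 conv f' g'.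
Proof. by move=> ff gg x; apply: eq_tensor_lift => u v; rewrite ff gg. Qed.

Lemma conv_lcombl c f f' g x :
  conv (fun x => c *: f x + f' x) g x = c *: conv f g x + conv f' g x.
Proof.
rewrite -tensor_lift_lcomb; apply: eq_tensor_lift => u v.
exact: (heis_bilinear k).1.
Qed.

Lemma conv_lcombr c f g g' x :
  conv f (fun x => c *: g x + g' x) x = c *: conv f g x + conv f g' x.
Proof.
rewrite -tensor_lift_lcomb; apply: eq_tensor_lift => u v.
exact: (heis_bilinear k).2.
Qed.

(** The projection onto the kernel of the counit along the unit. *)
Definition aug (x : S) : S := x - conv_unit x.

Lemma aug_linear : linear aug.
Proof.
by move=> c x y; rewrite /aug conv_unit_linear scalerBr opprD addrACA.
Qed.

Fixpoint aug_pow (m : nat) : S -> S :=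
  if m is m'.+1 then conv aug (aug_pow m') else conv_unit.

Lemma aug_pow_linear m : linear (aug_pow m).
Proof.
elim: m => [|m IHm]; first exact: conv_unit_linear.
exact: conv_linear aug_linear IHm.
Qed.

(** The powers are built by multiplication on the left; associativity gives the right-hand recursion
    needed for a two-sided inverse. *)
Lemma conv_aug_pow m : conv (aug_pow m) aug =1 aug_pow m.+1.
Proof.
have la := aug_linear; have lp := aug_pow_linear.
elim: m => [|m IHm] x /=; first by rewrite conv1f // convf1.
by rewrite convA //; apply: eq_conv.
Qed.

(** The scalar 1 gives the shape expected by [conv_lcombl] and [conv_lcombr]. *)
Lemma id_aug x : x = 1 *: aug x + conv_unit x.
Proof. by rewrite scale1r subrK. Qed.

Lemma conv_aug_pow_id m x : conv (aug_pow m) id x = aug_pow m.+1 x + aug_pow m x.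
Proof.
rewrite (eq_conv (fun=> erefl) id_aug) conv_lcombr scale1r conv_aug_pow.
by rewrite convf1 //; apply: aug_pow_linear.
Qed.

Lemma conv_id_aug_pow m x : conv id (aug_pow m) x = aug_pow m.+1 x + aug_pow m x.
Proof.
rewrite (eq_conv id_aug (fun=> erefl)) conv_lcombl scale1r.
by rewrite conv1f //; apply: aug_pow_linear.
Qed.

(** A partial sum of the geometric series for the convolution inverse of [conv_unit] plus [aug],
    that is, of the identity. *)
Definition alt_sum (n : nat) (x : S) : S :=
  \sum_(0 <= m < n) (-1) ^+ m *: aug_pow m x.

Lemma alt_sum0 x : alt_sum 0 x = 0.
Proof. by rewrite /alt_sum big_geq. Qed.

Lemma alt_sumS n x : alt_sum n.+1 x = (-1) ^+ n *: aug_pow n x + alt_sum n x.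
Proof. by rewrite /alt_sum big_nat_recr //= addrC. Qed.

Lemma telescope_step n (y u v : S) :
  (-1) ^+ n *: (u + v) + (y - (-1) ^+ n *: v) = y - (-1) ^+ n.+1 *: u.
Proof.
by rewrite scalerDr exprS mulN1r scaleNr opprK addrACA subrr addr0 addrC.
Qed.

(** Since the identity is [aug] plus the unit, convolving the m-th power with it gives two
    consecutive powers, and the alternating sum telescopes. *)
Lemma alt_sum_conv n x :
  conv (alt_sum n) id x = conv_unit x - (-1) ^+ n *: aug_pow n x.
Proof.
elim: n => [|n IHn].
  rewrite scale1r subrr; apply: big1 => p _.
  by rewrite alt_sum0 (linear_zero ((heis_bilinear k).1 _)) scaler0.
rewrite (eq_conv (alt_sumS n) (fun=> erefl)) conv_lcombl IHn conv_aug_pow_id.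
exact: telescope_step.
Qed.

Lemma conv_alt_sum n x :
  conv id (alt_sum n) x = conv_unit x - (-1) ^+ n *: aug_pow n x.
Proof.
elim: n => [|n IHn].
  rewrite scale1r subrr; apply: big1 => p _.
  by rewrite alt_sum0 (linear_zero ((heis_bilinear k).2 _)) scaler0.
rewrite (eq_conv (fun=> erefl) (alt_sumS n)) conv_lcombr IHn conv_id_aug_pow.
exact: telescope_step.
Qed.

Lemma aug_Xw0 (I : finType) : aug (Xw k (fun _ : I => 0%N)) = 0.
Proof.
rewrite /aug /conv_unit Sigma_eps_Xw; case: forallP => [_|[]//].
rewrite scale1r (_ : Xw k _ = Sigma_one) ?subrr //; congr X.
by apply: val_inj; rewrite val_hat; elim: (enum I).
Qed.

(* Each factor [aug] consumes a nonzero part of [a], so the convolution powers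
   of [aug] vanish on elements of small degree. *)
Lemma aug_pow_Xw (I : finType) (a : I -> nat) m :
  (\sum_i a i < m)%N -> aug_pow m (Xw k a) = 0.
Proof.
have hb := heis_bilinear k.
elim: m a => // m IHm a lt_am /=.
rewrite conv_Xw; [|exact: aug_linear|exact: aug_pow_linear].
apply: fsbig1 => -[b c] /= bc.
have [/forallP b0|] := boolP [forall i, b i == 0%N].
  rewrite (_ : b = fun=> 0%N); last by apply: funext => i; apply/eqP.
  by rewrite aug_Xw0 (linear_zero (hb.1 _)).
rewrite negb_forall => /existsP[i bi]; rewrite IHm ?(linear_zero (hb.2 _)) //.
rewrite -ltnS (leq_trans _ lt_am) // !ltnS (bigD1 i) // [ltnRHS](bigD1 i) //=.
rewrite -bc /= -addSn leq_add //.
  by rewrite -[X in (X < _)%N]add0n ltn_add2r lt0n.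
by apply: leq_sum => j _; rewrite -bc leq_addl.
Qed.

(** The series is cut after the power equal to the degree of [alpha]; all higher powers of [aug]
    vanish on [X k alpha]. *)
Definition antipode : S -> S :=
  Sigma_lift (fun alpha => alt_sum (sumn (val alpha)).+1 (X k alpha)).

Lemma antipode_linear : linear antipode.
Proof. exact: Sigma_lift_linear. Qed.

(** Raising the cut-off only adds vanishing terms, so one [n] can serve several weak compositions at
    once. *)
Lemma antipode_Xw (I : finType) (a : I -> nat) n :
  (\sum_i a i < n)%N -> antipode (Xw k a) = alt_sum n (Xw k a).
Proof.
move=> lt_an; rewrite /antipode Sigma_liftX sumn_hat -/(Xw k a) -(subnK lt_an).
elim: (n - _)%N => // m IHm; rewrite addSn [RHS]alt_sumS -IHm aug_pow_Xw ?leq_addl //.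
by rewrite scaler0 add0r.
Qed.

Lemma alt_sum_linear n : linear (alt_sum n).
Proof.
move=> c x y; rewrite /alt_sum scaler_sumr -big_split; apply: eq_bigr => m _ /=.
by rewrite aug_pow_linear scalerDr !scalerA mulrC.
Qed.

Lemma antipode_is_antipode :
  is_antipode (@heis k) Sigma_one (@SigmaDelta k) (@Sigma_eps k) antipode.
Proof.
have lS := antipode_linear; have lI := @linear_idfun k S.
have split_lt (I : finType) (a : I -> nat) p : splits a p ->
    (\sum_i p.1 i < (\sum_i a i).+1)%N /\ (\sum_i p.2 i < (\sum_i a i).+1)%N.
  by move=> pa; rewrite !ltnS; split; apply: leq_sum => i _;
    rewrite -pa ?leq_addr ?leq_addl.
split=> //.
  apply: (Sigma_ext (conv_linear lS lI) conv_unit_linear) => alpha.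
  rewrite X_Xw; set a := (X in Xw k X).
  (* Both halves of a split have total at most that of [a], so this single cut-off computes the
     antipode on all of them; the remainder left by telescoping vanishes on [Xw k a]. *)
  transitivity (conv (alt_sum (\sum_i a i).+1) id (Xw k a)).
    rewrite !conv_Xw //; last exact: alt_sum_linear.
    apply: eq_fsbig_set => p /split_lt[lt1 _].
    by rewrite -(antipode_Xw lt1).
  by rewrite alt_sum_conv aug_pow_Xw // scaler0 subr0.
apply: (Sigma_ext (conv_linear lI lS) conv_unit_linear) => alpha.
rewrite X_Xw; set a := (X in Xw k X).
transitivity (conv id (alt_sum (\sum_i a i).+1) (Xw k a)).
  rewrite !conv_Xw //; last exact: alt_sum_linear.
  apply: eq_fsbig_set => p /split_lt[_ lt2].
  by rewrite -(antipode_Xw lt2).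
by rewrite conv_alt_sum aug_pow_Xw // scaler0 subr0.
Qed.

End Antipode.

Theorem theorem9p2 (k : fieldType) (char0 : [pchar k]%R =i pred0) :
  is_hopf_algebra (@heis k) Sigma_one (@SigmaDelta k) (@Sigma_eps k)
  /\ cocommutative (@SigmaDelta k).
Proof.
split; last exact: Sigma_cocommutative.
split; first exact: Sigma_is_bialgebra.
by exists (@antipode k); apply: antipode_is_antipode.
Qed.
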